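(* Let $R$ be a commutative ring and let $G$ be a group. Then every cofibrant $RG$-module $M$ is PGF.
   Context: Rings are associative and unital; modules are left modules unless stated otherwise. An $RG$-module is projectively coresolved Gorenstein flat (PGF) if it is a syzygy (image of a differential) of an acyclic (unbounded) complex $\mathbf{P}$ of projective $RG$-modules such that $I\otimes_{RG}\mathbf{P}$ is acyclic for every injective right $RG$-module $I$. $B(G,R)$ is the $RG$-module of all functions $f:G\to R$ whose image is a finite subset of $R$, with pointwise $R$-module structure and $G$ acting by translation, $(gf)(x)=f(g^{-1}x)$. For $RG$-modules $M,N$, the tensor product $M\otimes_R N$ is an $RG$-module via the diagonal action $g(x\otimes y)=gx\otimes gy$. An $RG$-module $M$ is cofibrant if the $RG$-module $M\otimes_R B(G,R)$ (diagonal action) is projective. *)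

(* Defs.v *)
From HB Require Import structures.
From mathcomp Require Import all_boot all_algebra.
From mathcomp Require Import finmap boolp classical_sets functions cardinality.
From mathcomp Require Import fsbigop.
From mathcomp.multinomials Require Import freeg.

Set Implicit Arguments.
Unset Strict Implicit.
Unset Printing Implicit Defensive.

Import GRing.Theory.
Local Open Scope ring_scope.
Local Open Scope quotient_scope.
Local Open Scope classical_set_scope.

(* In this file, all rings are [pzRingType]s, so that the zero ring is
   allowed, and a right S-module is an [lmodType] over the converse ring
   [S^c]: the element x.s is written [s *: x]. *)

Section HomologicalAlgebra.
Variable S : pzRingType.

Definition projective (P : lmodType S) : Prop :=
  forall (A B : lmodType S) (g : {linear A -> B}) (f : {linear P -> B}),
    (forall b, exists a, g a = b) ->
    exists h : {linear P -> A}, forall x, g (h x) = f x.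

Definition injective_module (I : lmodType S) : Prop :=
  forall (A B : lmodType S) (i : {linear A -> B}) (f : {linear A -> I}),
    injective i -> exists h : {linear B -> I}, forall a, h (i a) = f a.

End HomologicalAlgebra.

(* Complexes are indexed homologically, d_i : C_(i+1) -> C_i for i in int; the
   right-to-left implication below says that d_i d_(i+1) = 0. *)
Definition acyclic (C : int -> zmodType) (d : forall i, C (i + 1) -> C i) :=
  forall (i : int) (x : C (i + 1)),
    d i x = 0 <-> exists y : C (i + 1 + 1), d (i + 1) y = x.

Section Tensor.
Variables (S : pzRingType) (X : lmodType S^c) (Y : lmodType S).

Inductive tensor_rel : {freeg (X * Y)%type / int} -> Prop :=
| TensorDl x x' y :
    tensor_rel (<< (x + x', y) >> - << (x, y) >> - << (x', y) >>)
| TensorDr x y y' :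
    tensor_rel (<< (x, y + y') >> - << (x, y) >> - << (x, y') >>)
| TensorZ (s : S) x y :
    tensor_rel (<< ((s : S^c) *: x, y) >> - << (x, s *: y) >>)
| Tensor0 : tensor_rel 0
| TensorB u v : tensor_rel u -> tensor_rel v -> tensor_rel (u - v).

Definition tensor_ker : pred {freeg (X * Y)%type / int} :=
  fun u => `[< tensor_rel u >].

Lemma tensor_ker_zmod_closed : zmod_closed tensor_ker.
Proof.
split; first by apply/asboolP; exact: Tensor0.
by move=> u v /asboolP hu /asboolP hv; apply/asboolP; exact: TensorB.
Qed.

HB.instance Definition _ := GRing.isZmodClosed.Build _ tensor_ker
  tensor_ker_zmod_closed.

Definition tensor : Type :=
  Quotient.quot (GRing.ZmodClosed.clone _ tensor_ker _).
HB.instance Definition _ := GRing.Zmodule.on tensor.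

Definition tpure (x : X) (y : Y) : tensor := \pi_tensor << (x, y) >>.

Lemma tensor_ind (P : tensor -> Prop) :
    P 0 -> (forall u v, P u -> P v -> P (u - v)) ->
  (forall x y, P (tpure x y)) -> forall t, P t.
Proof.
move=> P0 PB Pp t; rewrite -[t]reprK; set u := repr t.
have PN v : P v -> P (- v) by move=> Pv; rewrite -[- v]add0r; exact: PB.
have PD v w : P v -> P w -> P (v + w).
  by move=> Pv Pw; rewrite -[w]opprK; apply: PB => //; exact: PN.
have PM v n : P v -> P (v *+ n).
  by move=> Pv; elim: n => [|n IH]; rewrite ?mulr0n// mulrS; exact: PD.
have PZ v (n : int) : P v -> P (v *~ n).
  by move=> Pv; case: n => n; rewrite ?NegzE ?mulrNz; [|apply: PN]; exact: PM.
rewrite -(freeg_sumE u) raddf_sum /=; elim/big_rec: _ => // -[x y] w _ Pw.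
apply: PD => //; rewrite -[coeff _ _]intz -freegU_mulz raddfMz.
exact/PZ/Pp.
Qed.

(* Meaningful only when f is balanced, see below. *)
Definition tensor_lift (A : zmodType) (f : X -> Y -> A) (t : tensor) : A :=
  fglift (fun p => f p.1 p.2 : zmodule A) (repr t).

Definition balanced (A : zmodType) (f : X -> Y -> A) : Prop :=
  [/\ forall x x' y, f (x + x') y = f x y + f x' y,
      forall x y y', f x (y + y') = f x y + f x y'
    & forall (s : S) x y, f ((s : S^c) *: x) y = f x (s *: y)].

Lemma tpure_balanced : balanced tpure.
Proof.
split=> [x x' y|x y y'|s x y]; rewrite /tpure -?raddfD; apply/eqP;
  rewrite -Quotient.idealrBE ?opprD ?addrA; apply/asboolP.
- exact: TensorDl.
- exact: TensorDr.
- exact: TensorZ.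
Qed.

Section Lift.
Variables (A : zmodType) (f : X -> Y -> A).
Hypothesis fB : balanced f.

Let F : {freeg (X * Y)%type / int} -> A :=
  fglift (fun p => f p.1 p.2 : zmodule A).

Let FB : {morph F : u v / u - v}.
Proof.
exact: (@lift_is_additive int _ (zmodule A) (fun p : X * Y => f p.1 p.2)).
Qed.

Let FU x y : F << (x, y) >> = f x y.
Proof. by rewrite /F liftU scale1r. Qed.

Lemma tensor_lift_rel u :
  tensor_rel u -> F u = 0.
Proof.
case: fB => fDl fDr fZ.
elim=> [x x' y|x y y'|s x y||{}u v _ IHu _ IHv].
- by rewrite !FB !FU fDl -addrA -opprD subrr.
- by rewrite !FB !FU fDr -addrA -opprD subrr.
- by rewrite !FB !FU fZ subrr.
- by have := FB 0 0; rewrite !subrr.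
- by rewrite FB IHu IHv subrr.
Qed.

Lemma tensor_lift_pi u :
  tensor_lift f (\pi_tensor u) = F u.
Proof.
apply/eqP; rewrite -subr_eq0 -[tensor_lift f _]/(F _) -FB.
apply/eqP/tensor_lift_rel/asboolP.
by rewrite -[asbool _]/(_ \in tensor_ker) Quotient.idealrBE reprK.
Qed.

Lemma tensor_lift_is_zmod_morphism : zmod_morphism (tensor_lift f).
Proof.
move=> t t'; rewrite -[t]reprK -[t']reprK -raddfB !tensor_lift_pi.
exact: FB.
Qed.

Lemma tensor_lift_pure x y : tensor_lift f (tpure x y) = f x y.
Proof.
by rewrite tensor_lift_pi FU.
Qed.
End Lift.

End Tensor.

Section TensorMap.
Variables (S : pzRingType) (X X' : lmodType S^c) (Y Y' : lmodType S).
Variables (f : {linear X -> X'}) (g : {linear Y -> Y'}).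

Definition tensor_map : tensor X Y -> tensor X' Y' :=
  tensor_lift (fun x y => tpure (f x) (g y)).

Lemma tensor_map_balanced : balanced (fun x y => tpure (f x) (g y)).
Proof.
have [pDl pDr pZ] := @tpure_balanced S X' Y'.
split=> *; rewrite ?raddfD ?pDl ?pDr ?linearZ ?pZ //.
Qed.

HB.instance Definition _ := GRing.isZmodMorphism.Build _ _ tensor_map
  (tensor_lift_is_zmod_morphism tensor_map_balanced).

Lemma tensor_map_pure x y : tensor_map (tpure x y) = tpure (f x) (g y).
Proof. exact: (tensor_lift_pure tensor_map_balanced). Qed.
End TensorMap.

(* The last clause says that M is isomorphic to the image of d_i. *)
Definition PGF (S : pzRingType) (M : lmodType S) : Prop :=
  exists (P : int -> lmodType S) (d : forall i, {linear P (i + 1) -> P i}),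
    [/\ forall i, projective (P i),
        acyclic d,
        forall I : lmodType S^c, injective_module I ->
          acyclic (fun i => tensor_map (idfun : {linear I -> I}) (d i))
      & exists (i : int) (e : {linear M -> P i}),
          injective e /\ forall y, (exists m, e m = y) <-> (exists x, d i x = y)].

Section GroupRing.
Variables (R : comPzRingType) (G : groupType).

Definition finitely_supported : pred (G -> R^o) :=
  fun a => `[< finite_set [set x | a x != 0] >].

Lemma finitely_supported_submod_closed : submod_closed finitely_supported.
Proof.
split=> [|r a b /asboolP fa /asboolP fb]; apply/asboolP.
  by rewrite (_ : mkset _ = set0) //; apply/seteqP; split=> x //=; rewrite eqxx.
apply: (@sub_finite_set _ _ ([set x | a x != 0] `|` [set x | b x != 0])).
  move=> x /=; apply: contraNP => /not_orP[/negP/negPn/eqP ax /negP/negPn/eqP bx].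
  by rewrite [X in X == _](_ : _ = r *: a x + b x) // ax bx scaler0 addr0.
by rewrite finite_setU.
Qed.

HB.instance Definition _ := GRing.isSubmodClosed.Build R (G -> R^o)
  finitely_supported finitely_supported_submod_closed.

Record group_ring : Type := GroupRing {
  gr_coef :> G -> R^o;
  _ : finitely_supported gr_coef }.

HB.instance Definition _ := [isSub for gr_coef].
HB.instance Definition _ := [Choice of group_ring by <:].
HB.instance Definition _ := [SubChoice_isSubLmodule of group_ring by <:].

Implicit Types (a b c : group_ring) (g h x y : G) (r s : R).

(* The (finite) sum of the a_g F(g) over all g in G. *)
Definition gr_sum (V : lmodType R) (a : group_ring) (F : G -> V) : V :=
  \sum_(g \in [set: G]) (a g : R) *: F g.

Lemma gr_supp a : finite_set [set x | a x != 0].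
Proof. by have /asboolP := valP a. Qed.

Definition gr_fsupp a : {fset G} := fset_set [set x | a x != 0].

Lemma gr_fsuppP a x : x \notin gr_fsupp a -> a x = 0.
Proof.
by rewrite in_fset_set; [rewrite notin_setE /= => /negP/negPn/eqP|exact: gr_supp].
Qed.

Lemma gr_sumE (V : lmodType R) a (F : G -> V) (A : {fset G}) :
  (forall x, x \notin A -> a x = 0) ->
  gr_sum a F = \sum_(g <- A) (a g : R) *: F g.
Proof. by move=> aA; apply: fsbigTE => x /aA ->; rewrite scale0r. Qed.

Lemma gr_sum_fsupp (V : lmodType R) a (F : G -> V) :
  gr_sum a F = \sum_(g <- gr_fsupp a) (a g : R) *: F g.
Proof. by apply: gr_sumE => x; exact: gr_fsuppP. Qed.

Lemma gr_ext a b : (forall x, a x = b x) -> a = b.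
Proof. by move=> ab; apply/val_inj/funext. Qed.

Definition gr_delta_fun (r : R) (g : G) : G -> R^o :=
  fun x => if x == g then r else 0.

Lemma gr_delta_finite r g : finitely_supported (gr_delta_fun r g).
Proof.
apply/asboolP/(@sub_finite_set _ _ [set g]); last exact: finite_set1.
by move=> x /=; rewrite /gr_delta_fun; case: (x =P g) => [-> //|_]; rewrite eqxx.
Qed.

Definition gr_delta r g : group_ring := GroupRing (gr_delta_finite r g).

(* Convolution: (ab)(x) is the sum of the a(y) b(y^-1 x). *)
Definition gr_mul_fun a b : G -> R^o :=
  fun x => gr_sum a (fun y => b (y^-1 * x)%g).

(* Contains the products of the elements of the supports of a and b. *)
Definition gr_msupp a b : {fset G} :=
  [fset (y * w)%g | y in gr_fsupp a, w in gr_fsupp b]%fset.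

Lemma gr_msuppP a b y z :
  y \in gr_fsupp a -> z \notin gr_msupp a b -> b (y^-1 * z)%g = 0.
Proof.
move=> ya zN; apply: gr_fsuppP; apply: contra zN => wb.
by apply/imfset2P; exists y => //; exists (y^-1 * z)%g => //; rewrite mulgA mulgV mul1g.
Qed.

Lemma gr_mul_fun0 a b z : z \notin gr_msupp a b -> gr_mul_fun a b z = 0.
Proof.
move=> zN; rewrite /gr_mul_fun gr_sum_fsupp big_seq big1 // => y ya.
by rewrite (gr_msuppP ya zN) scaler0.
Qed.

Lemma gr_mul_finite a b : finitely_supported (gr_mul_fun a b).
Proof.
apply/asboolP/(@sub_finite_set _ _ [set` gr_msupp a b]); last exact: finite_fset.
by move=> z /=; apply: contraNT => /gr_mul_fun0 ->.
Qed.

Definition gr_mul a b : group_ring := GroupRing (gr_mul_finite a b).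
Definition gr_one : group_ring := gr_delta 1 1%g.

Section GrSum.
Variable V : lmodType R.
Implicit Types F : G -> V.

Lemma gr_sum_delta r g F : gr_sum (gr_delta r g) F = r *: F g.
Proof.
rewrite (@gr_sumE _ _ _ [fset g]%fset) ?big_seq_fset1 /= /gr_delta_fun ?eqxx //.
by move=> x; rewrite inE => /negPf ->.
Qed.

Lemma gr_sumDl a b F : gr_sum (a + b) F = gr_sum a F + gr_sum b F.
Proof.
pose A := (gr_fsupp a `|` gr_fsupp b)%fset.
have aA x : x \notin A -> a x = 0 by rewrite inE => /norP[/gr_fsuppP].
have bA x : x \notin A -> b x = 0 by rewrite inE => /norP[_ /gr_fsuppP].
have abA x : x \notin A -> (a + b) x = 0.
  by move=> xA; rewrite [LHS](_ : _ = a x + b x) // aA // bA // addr0.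
rewrite (gr_sumE _ aA) (gr_sumE _ bA) (gr_sumE _ abA) -big_split /=.
by apply: eq_bigr => g _; rewrite -scalerDl.
Qed.

Lemma gr_sumDr a F F' :
  gr_sum a (fun g => F g + F' g) = gr_sum a F + gr_sum a F'.
Proof.
rewrite !gr_sum_fsupp -big_split /=.
by apply: eq_bigr => g _; rewrite scalerDr.
Qed.

Lemma gr_sum_linear (W : lmodType R) (f : {linear V -> W}) a F :
  f (gr_sum a F) = gr_sum a (fun g => f (F g)).
Proof.
by rewrite !gr_sum_fsupp linear_sum /=; apply: eq_bigr => g _; rewrite linearZ.
Qed.

Lemma gr_sum_mul a b F :
  gr_sum (gr_mul a b) F = gr_sum a (fun y => gr_sum b (fun w => F (y * w)%g)).
Proof.
rewrite (@gr_sumE _ (gr_mul a b) _ _ (@gr_mul_fun0 a b)) gr_sum_fsupp /=.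
under eq_bigr do rewrite /gr_mul_fun gr_sum_fsupp scaler_suml.
rewrite exchange_big /= big_seq [RHS]big_seq; apply: eq_bigr => y ya.
under eq_bigr do rewrite -scalerA.
rewrite -scaler_sumr; congr (_ *: _).
rewrite /gr_sum -(fsbigTE (gr_msupp a b) (fun z => (b (y^-1 * z)%g : R) *: F z)).
  rewrite (reindex_fsbigT (fun w => y * w)%g).
    by apply: eq_fsbigr => w _; rewrite mulgA mulVg mul1g.
  by exists (fun z => y^-1 * z)%g => z; rewrite mulgA ?mulVg ?mulgV mul1g.
by move=> z /(gr_msuppP ya) ->; rewrite scale0r.
Qed.
End GrSum.

Lemma gr_mulA : associative gr_mul.
Proof.
move=> a b c; apply: gr_ext => x /=; rewrite /gr_mul_fun.
rewrite gr_sum_mul; congr (gr_sum a _); apply/funext => y /=.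
by congr (gr_sum b _); apply/funext => w; rewrite invgM mulgA.
Qed.

Lemma gr_mul1r : left_id gr_one gr_mul.
Proof.
move=> a; apply: gr_ext => x /=; rewrite /gr_mul_fun gr_sum_delta.
by rewrite invg1 mul1g scale1r.
Qed.

Lemma gr_mulr1 : right_id gr_one gr_mul.
Proof.
move=> a; apply: gr_ext => x /=; rewrite /gr_mul_fun /gr_sum.
rewrite (fsbigTE [fset x]%fset) ?big_seq_fset1 /= /gr_delta_fun => [|y].
  by rewrite mulVg eqxx [LHS]mulr1.
rewrite inE => yx; case: eqP => [e|_]; last by rewrite scaler0.
by case/eqP: yx; rewrite -[LHS]mulg1 -e mulgA mulgV mul1g.
Qed.

Lemma gr_mulDl : left_distributive gr_mul +%R.
Proof. by move=> a b c; apply: gr_ext => x /=; rewrite /gr_mul_fun gr_sumDl. Qed.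

Lemma gr_mulDr : right_distributive gr_mul +%R.
Proof. by move=> a b c; apply: gr_ext => x; exact: gr_sumDr. Qed.

HB.instance Definition _ := GRing.Zmodule_isPzRing.Build group_ring
  gr_mulA gr_mul1r gr_mulr1 gr_mulDl gr_mulDr.

Lemma gr_deltaM r s g h :
  gr_delta r g * gr_delta s h = gr_delta (r * s) (g * h)%g.
Proof.
apply: gr_ext => x; rewrite -[LHS]/(gr_sum _ _) gr_sum_delta /= /gr_delta_fun.
rewrite [X in _ = if X then _ else _](_ : _ = (g^-1 * x == h)%g).
  by case: ifP; rewrite ?scaler0.
by apply/eqP/eqP => [->|<-]; rewrite mulgA ?mulVg ?mulgV mul1g.
Qed.

Lemma gr_deltaD r s g : gr_delta (r + s) g = gr_delta r g + gr_delta s g.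
Proof.
apply: gr_ext => x; rewrite [RHS](_ : _ = gr_delta r g x + gr_delta s g x) //=.
by rewrite /gr_delta_fun; case: ifP; rewrite ?addr0.
Qed.

(* An R-module with an R-linear G-action, and the RG-module it defines. *)
Record gaction (V : lmodType R) := GAction {
  gact :> G -> {linear V -> V};
  gact1 : forall v, gact 1%g v = v;
  gactM : forall g h v, gact (g * h)%g v = gact g (gact h v) }.

Section GroupRingModule.
Variables (V : lmodType R) (act : gaction V).

(* The let makes the type depend on the action. *)
Definition grmod : Type := let _ := act in V.
HB.instance Definition _ := GRing.Zmodule.copy grmod V.

Definition grmod_scale (a : group_ring) (v : grmod) : grmod :=
  gr_sum a (fun g => act g v).

Lemma grmod_scaleA a b v :
  grmod_scale a (grmod_scale b v) = grmod_scale (a * b) v.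
Proof.
rewrite [RHS]gr_sum_mul; congr (gr_sum a _); apply/funext => y.
rewrite gr_sum_linear; congr (gr_sum b _); apply/funext => w.
by rewrite gactM.
Qed.

Lemma grmod_scale1 : left_id 1 grmod_scale.
Proof.
by move=> v; rewrite /grmod_scale gr_sum_delta gact1 scale1r.
Qed.

Lemma grmod_scaleDr : right_distributive grmod_scale +%R.
Proof.
move=> a u v; rewrite /grmod_scale -gr_sumDr; congr (gr_sum a _).
by apply/funext => g; rewrite raddfD.
Qed.

Lemma grmod_scaleDl v : {morph grmod_scale^~ v : a b / a + b}.
Proof.
by move=> a b; exact: gr_sumDl.
Qed.

HB.instance Definition _ := GRing.Zmodule_isLmodule.Build group_ring grmod
  grmod_scaleA grmod_scale1 grmod_scaleDr grmod_scaleDl.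
End GroupRingModule.

Section Restriction.
Variable M : lmodType group_ring.

Definition resmod : Type := M.
HB.instance Definition _ := GRing.Zmodule.on resmod.

Definition resmod_scale (r : R) (m : resmod) : resmod :=
  gr_delta r 1%g *: (m : M).

Lemma resmod_scaleA r s m :
  resmod_scale r (resmod_scale s m) = resmod_scale (r * s) m.
Proof. by rewrite /resmod_scale scalerA gr_deltaM mulg1. Qed.

Lemma resmod_scale1 : left_id 1 resmod_scale.
Proof. exact: (@scale1r _ M). Qed.

Lemma resmod_scaleDr : right_distributive resmod_scale +%R.
Proof. by move=> r u v; exact: (@scalerDr _ M). Qed.

Lemma resmod_scaleDl v : {morph resmod_scale^~ v : r s / r + s}.
Proof. by move=> r s; rewrite /resmod_scale gr_deltaD scalerDl. Qed.

HB.instance Definition _ := GRing.Zmodule_isLmodule.Build R resmod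
  resmod_scaleA resmod_scale1 resmod_scaleDr resmod_scaleDl.

Definition resmod_act (g : G) (m : resmod) : resmod := gr_delta 1 g *: (m : M).

Lemma resmod_act_linear g : linear (resmod_act g).
Proof.
move=> r u v; rewrite /resmod_act [LHS]scalerDr; congr (_ + _).
rewrite [LHS]scalerA [RHS](_ : _ = gr_delta r 1%g *: (gr_delta 1 g *: (u : M))) //.
by rewrite scalerA !gr_deltaM mulr1 mul1r mulg1 mul1g.
Qed.

HB.instance Definition _ g := GRing.isLinear.Build R resmod resmod _
  (resmod_act g) (resmod_act_linear g).
End Restriction.

End GroupRing.

(* Over a commutative ring, a module is also a right module (rightmod) and
   the tensor product is again a module. *)
Section CommTensor.
Variable R : comPzRingType.

Section RightModule.
Variable X : lmodType R.

Definition rightmod : Type := X.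
HB.instance Definition _ := GRing.Zmodule.on rightmod.

Definition rightmod_scale (r : R^c) (x : rightmod) : rightmod :=
  (r : R) *: (x : X).

Lemma rightmod_scaleA r s x :
  rightmod_scale r (rightmod_scale s x) = rightmod_scale (r * s) x.
Proof. by rewrite /rightmod_scale scalerA mulrC. Qed.

Lemma rightmod_scale1 : left_id 1 rightmod_scale.
Proof. exact: (@scale1r _ X). Qed.

Lemma rightmod_scaleDr : right_distributive rightmod_scale +%R.
Proof. by move=> r u v; exact: (@scalerDr _ X). Qed.

Lemma rightmod_scaleDl v : {morph rightmod_scale^~ v : r s / r + s}.
Proof. by move=> r s; exact: (@scalerDl _ X). Qed.

HB.instance Definition _ := GRing.Zmodule_isLmodule.Build R^c rightmod
  rightmod_scaleA rightmod_scale1 rightmod_scaleDr rightmod_scaleDl.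
End RightModule.

Section CommTensorModule.
Variables X Y : lmodType R.

Definition ctensor : Type := tensor (rightmod X) Y.
HB.instance Definition _ := GRing.Zmodule.on ctensor.

Definition cpure (x : X) (y : Y) : ctensor := tpure (x : rightmod X) y.

Definition ctensor_scale (r : R) : ctensor -> ctensor :=
  @tensor_lift R (rightmod X) Y _ (fun x y => cpure (r *: (x : X)) y).

Lemma cpureDl x x' y : cpure (x + x') y = cpure x y + cpure x' y.
Proof. by case: (@tpure_balanced R (rightmod X) Y) => + _ _; exact. Qed.

Lemma cpureDr x y y' : cpure x (y + y') = cpure x y + cpure x y'.
Proof. by case: (@tpure_balanced R (rightmod X) Y) => _ + _; exact. Qed.

Lemma cpureZ (r : R) x y : cpure (r *: x) y = cpure x (r *: y).
Proof. by case: (@tpure_balanced R (rightmod X) Y) => _ _; exact. Qed.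

Lemma ctensor_ind (P : ctensor -> Prop) :
    P 0 -> (forall u v, P u -> P v -> P (u - v)) ->
  (forall x y, P (cpure x y)) -> forall t, P t.
Proof. exact: tensor_ind. Qed.

Lemma ctensor_scale_balanced r :
  @balanced R (rightmod X) Y _ (fun x y => cpure (r *: (x : X)) y).
Proof.
split=> [x x' y|x y y'|s x y].
- by rewrite -cpureDl -scalerDr.
- by rewrite cpureDr.
- rewrite -cpureZ [_ *: x](_ : _ = (s : R) *: (x : X)) // !scalerA.
  by rewrite mulrC.
Qed.

Lemma ctensor_scaleB r : {morph ctensor_scale r : t u / t - u}.
Proof. exact: (tensor_lift_is_zmod_morphism (ctensor_scale_balanced r)). Qed.

Lemma ctensor_scale_pure r x y :
  ctensor_scale r (cpure x y) = cpure (r *: x) y.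
Proof. exact: (tensor_lift_pure (ctensor_scale_balanced r)). Qed.

Lemma ctensor_scale0 r : ctensor_scale r 0 = 0.
Proof. by have := ctensor_scaleB r 0 0; rewrite !subrr. Qed.

Lemma ctensor_scaleA r s t :
  ctensor_scale r (ctensor_scale s t) = ctensor_scale (r * s) t.
Proof.
elim/ctensor_ind: t => [|u v IHu IHv|x y]; first by rewrite !ctensor_scale0.
  by rewrite !ctensor_scaleB IHu IHv.
by rewrite !ctensor_scale_pure scalerA.
Qed.

Lemma ctensor_scale1 : left_id 1 ctensor_scale.
Proof.
elim/ctensor_ind => [|u v IHu IHv|x y]; first by rewrite ctensor_scale0.
  by rewrite ctensor_scaleB IHu IHv.
by rewrite ctensor_scale_pure scale1r.
Qed.

Lemma ctensor_scaleDr : right_distributive ctensor_scale +%R.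
Proof.
by move=> r u v; rewrite -[v]opprK ctensor_scaleB -[- v]sub0r !ctensor_scaleB
  ctensor_scale0 sub0r opprK sub0r opprK.
Qed.

Lemma ctensor_scaleDl t : {morph ctensor_scale^~ t : r s / r + s}.
Proof.
move=> r s; elim/ctensor_ind: t => [|u v IHu IHv|x y].
- by rewrite !ctensor_scale0 addr0.
- by rewrite !ctensor_scaleB IHu IHv opprD addrACA.
- by rewrite !ctensor_scale_pure scalerDl cpureDl.
Qed.

HB.instance Definition _ := GRing.Zmodule_isLmodule.Build R ctensor
  ctensor_scaleA ctensor_scale1 ctensor_scaleDr ctensor_scaleDl.

Lemma cscale_pure (r : R) x y : r *: cpure x y = cpure (r *: x) y.
Proof. exact: ctensor_scale_pure. Qed.
End CommTensorModule.

Section CommTensorMap.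
Variables (X X' Y Y' : lmodType R).
Variables (f : {linear X -> X'}) (g : {linear Y -> Y'}).

Definition ctensor_map : ctensor X Y -> ctensor X' Y' :=
  @tensor_lift R (rightmod X) Y _ (fun x y => cpure (f x) (g y)).

Lemma ctensor_map_balanced :
  @balanced R (rightmod X) Y _ (fun x y => cpure (f x) (g y)).
Proof.
split=> [x x' y|x y y'|s x y].
- by rewrite (raddfD f) cpureDl.
- by rewrite raddfD cpureDr.
- by rewrite (linearZ_LR f) linearZ_LR cpureZ.
Qed.

Lemma ctensor_mapB : {morph ctensor_map : t u / t - u}.
Proof. exact: (tensor_lift_is_zmod_morphism ctensor_map_balanced). Qed.

Lemma ctensor_map_pure x y : ctensor_map (cpure x y) = cpure (f x) (g y).
Proof. exact: (tensor_lift_pure ctensor_map_balanced). Qed.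

Lemma ctensor_map_linear : linear ctensor_map.
Proof.
have m0 : ctensor_map 0 = 0 by have := ctensor_mapB 0 0; rewrite !subrr.
move=> r t u; rewrite -[u]opprK ctensor_mapB -[- u]sub0r !ctensor_mapB m0.
rewrite !sub0r !opprK; congr (_ + _).
elim/ctensor_ind: t => [|v w IHv IHw|x y]; first by rewrite !(scaler0, m0).
  by rewrite scalerBr !ctensor_mapB IHv IHw scalerBr.
by rewrite cscale_pure !ctensor_map_pure cscale_pure linearZ_LR.
Qed.

HB.instance Definition _ := GRing.isLinear.Build R _ _ _
  ctensor_map ctensor_map_linear.
End CommTensorMap.

End CommTensor.

Section Cofibrant.
Variables (R : comPzRingType) (G : groupType).

Section Diagonal.
Variables M N : lmodType (group_ring R G).

Definition diag_act (g : G) :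
    {linear ctensor (resmod M) (resmod N) -> ctensor (resmod M) (resmod N)} :=
  ctensor_map (@resmod_act R G M g) (@resmod_act R G N g).

Lemma diag_actB g : {morph diag_act g : t u / t - u}.
Proof. exact: raddfB. Qed.

Lemma diag_act_pure g x y :
  diag_act g (cpure x y) = cpure (resmod_act g x) (resmod_act g y).
Proof. exact: ctensor_map_pure. Qed.

Lemma diag_act1 t : diag_act 1%g t = t.
Proof.
elim/ctensor_ind: t => [|u v IHu IHv|x y]; first exact: raddf0.
  by rewrite diag_actB IHu IHv.
by rewrite diag_act_pure /resmod_act !scale1r.
Qed.

Lemma diag_actM g h t : diag_act (g * h)%g t = diag_act g (diag_act h t).
Proof.
elim/ctensor_ind: t => [|u v IHu IHv|x y]; first by rewrite !raddf0.
  by rewrite !diag_actB IHu IHv.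
rewrite !diag_act_pure /resmod_act.
by congr cpure; rewrite scalerA gr_deltaM mulr1.
Qed.

Definition diag_tensor : lmodType (group_ring R G) :=
  grmod (GAction diag_act1 diag_actM).
End Diagonal.

Definition finite_range : pred (G -> R^o) := fun f => `[< finite_set (range f) >].

Lemma finite_range_submod_closed : submod_closed finite_range.
Proof.
split=> [|r a b /asboolP fa /asboolP fb]; apply/asboolP.
  apply: (@sub_finite_set _ _ [set 0]); last exact: finite_set1.
  by move=> _ [x _ <-].
apply: (@sub_finite_set _ _
  ((fun p : R^o * R^o => r *: p.1 + p.2) @` (range a `*` range b))).
  by move=> _ [x _ <-]; exists (a x, b x) => //; split; exists x.
by exact/finite_image/finite_setX.
Qed.

HB.instance Definition _ := GRing.isSubmodClosed.Build R (G -> R^o)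
  finite_range finite_range_submod_closed.

Record bounded_fun : Type := BoundedFun {
  bf_fun :> G -> R^o;
  _ : finite_range bf_fun }.

HB.instance Definition _ := [isSub for bf_fun].
HB.instance Definition _ := [Choice of bounded_fun by <:].
HB.instance Definition _ := [SubChoice_isSubLmodule of bounded_fun by <:].

Lemma translate_finite (g : G) (f : bounded_fun) :
  finite_range (fun x => f (g^-1 * x)%g).
Proof.
have /asboolP := valP f; move/sub_finite_set=> Hf; apply/asboolP/Hf.
by move=> _ [x _ <-]; exists (g^-1 * x)%g.
Qed.

Definition translate (g : G) (f : bounded_fun) : bounded_fun :=
  BoundedFun (translate_finite g f).

Lemma translate_linear g : linear (translate g).
Proof.
by move=> r u v; apply/val_inj.
Qed.

HB.instance Definition _ g := GRing.isLinear.Build R bounded_fun bounded_fun _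
  (translate g) (translate_linear g).

Lemma translate1 f : translate 1%g f = f.
Proof.
by apply/val_inj/funext => x /=; rewrite invg1 mul1g.
Qed.

Lemma translateM g h f : translate (g * h)%g f = translate g (translate h f).
Proof.
by apply/val_inj/funext => x /=; rewrite invgM mulgA.
Qed.

Definition BGR : lmodType (group_ring R G) :=
  grmod (@GAction R G bounded_fun translate translate1 translateM).

Definition cofibrant (M : lmodType (group_ring R G)) : Prop :=
  projective (diag_tensor M BGR).

End Cofibrant.

(* Main.v *)
Require Import Defs.
From HB Require Import structures.
From mathcomp Require Import all_boot all_algebra.
From mathcomp Require Import finmap boolp classical_sets functions cardinality.

Set Implicit Arguments.
Unset Strict Implicit.
Unset Printing Implicit Defensive.

Import GRing.Theory.
Local Open Scope ring_scope.
Local Open Scope quotient_scope.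

(* The left-hand resolution of M is spliced from 0 -> K -> M (x) RG -> M -> 0
   and the right-hand one from 0 -> M -> M (x) B -> N -> 0, where B = B(G,R).
   Both stay exact after tensoring with B, and then even split over RG: the
   first because M (x) B is projective, the second through the multiplication
   of B. So K and N are again cofibrant as soon as M (x) RG (x) B and
   M (x) B (x) B are projective. These follow from one fact, which spares us the
   freeness of B over R: if M (x) X is RG-projective and M (x) Y is
   R-projective, then M (x) X (x) Y is RG-projective.

   If I is an injective right module, then I -> I (x)_R B, x |-> x (x) 1, has a
   retraction over RG. It induces a map I (x)_RG (K (x)_R B) -> I (x)_RG K that
   is left inverse to x (x) k |-> x (x) k (x) 1, so the splitting of the
   sequences tensored with B makes I (x)_RG - exact on the original ones. *)

(** * Submodules, images and split short exact sequences *)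

Definition surjective (T U : Type) (f : T -> U) := forall y, exists x, f x = y.

Lemma zmod_morphism0 (U V : zmodType) (f : U -> V) : zmod_morphism f -> f 0 = 0.
Proof. by move=> fB; have := fB 0 0; rewrite !subrr. Qed.

Lemma zmod_morphismD (U V : zmodType) (f : U -> V) :
  zmod_morphism f -> {morph f : x y / x + y}.
Proof.
move=> fB x y; rewrite -{1}[y]opprK fB -[- y]sub0r fB (zmod_morphism0 fB).
by rewrite sub0r opprK.
Qed.

Section Modules.
Variable S : pzRingType.
Implicit Types A B C K P Q M V W : lmodType S.

Definition mk_linear V W (f : V -> W) (fl : linear f) : {linear V -> W} :=
  HB.pack f (GRing.isLinear.Build S V W *:%R f fl).

Definition short_exact K P M (i : {linear K -> P}) (p : {linear P -> M}) :=
  [/\ injective i, surjective p & forall x, p x = 0 <-> exists k, i k = x].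

Lemma short_exactE K P M (i : {linear K -> P}) (p : {linear P -> M})
  (e : short_exact i p) : forall k, p (i k) = 0.
Proof. by case: e => _ _ e k; apply/e; exists k. Qed.

Lemma retract_projective P Q (i : {linear Q -> P}) (r : {linear P -> Q}) :
  cancel i r -> projective P -> projective Q.
Proof.
move=> ir prP A B g f gs.
have [h hE] := prP A B g (f \o r : {linear P -> B}) gs.
by exists (h \o i : {linear Q -> A}) => x; rewrite /= hE /= ir.
Qed.

Section Submodule.
Variables (V : lmodType S) (D : submodClosed V).

Record submod : Type := Submod { submod_val :> V; _ : submod_val \in D }.
HB.instance Definition _ := [isSub for submod_val].
HB.instance Definition _ := [Choice of submod by <:].
HB.instance Definition _ := [SubChoice_isSubLmodule of submod by <:].

Lemma submod_linear W (f : W -> V) (fD : forall w, f w \in D) :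
  linear f -> linear (fun w => Submod (fD w)).
Proof. by move=> fl a u v; apply/val_inj/fl. Qed.
End Submodule.

Section KerIm.
Variables (V W : lmodType S) (f : {linear V -> W}).

Definition ker_pred : {pred V} := fun v => f v == 0.
Lemma ker_submod_closed : submod_closed ker_pred.
Proof.
split=> [|a u v]; rewrite !unfold_in ?linear0// => /eqP fu /eqP fv.
by rewrite linearP fu fv scaler0 addr0.
Qed.
HB.instance Definition _ := GRing.isSubmodClosed.Build S V
  ker_pred ker_submod_closed.

Definition im_pred : {pred W} := fun w => `[< exists v, f v = w >].
Lemma im_submod_closed : submod_closed im_pred.
Proof.
split=> [|a u v]; first by apply/asboolP; exists 0; rewrite linear0.
move=> /asboolP[x <-] /asboolP[y <-]; apply/asboolP.
by exists (a *: x + y); rewrite linearP.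
Qed.
HB.instance Definition _ := GRing.isSubmodClosed.Build S W
  im_pred im_submod_closed.

Definition kermod := submod ker_pred.
Definition immod := submod im_pred.

Lemma im_predP v : f v \in im_pred.
Proof. by apply/asboolP; exists v. Qed.

Definition to_im : {linear V -> immod} :=
  mk_linear (submod_linear im_predP (@linearP _ _ _ _ f)).

Lemma to_im_surj : surjective to_im.
Proof. by case=> w wf; have /asboolP[v fv] := wf; exists v; apply/val_inj. Qed.
End KerIm.

(** Here [g] need not be onto: projectivity is applied to its corestriction to the image, which
    contains all values of [f]. *)
Lemma projective_lift P A C (g : {linear A -> C}) (f : {linear P -> C}) :
    projective P -> (forall x, exists a, g a = f x) ->
  exists h : {linear P -> A}, forall x, g (h x) = f x.
Proof.
move=> prP fg.
have fD x : f x \in im_pred g by apply/asboolP.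
have fl := submod_linear fD (@linearP _ _ _ _ f).
have [h hE] := prP _ _ (to_im g) (mk_linear fl)
  (@to_im_surj _ _ g).
by exists h => x; have /(congr1 val) := hE x.
Qed.

Section Exact.
Variables (K P M : lmodType S) (i : {linear K -> P}) (p : {linear P -> M}).
Hypothesis ex : short_exact i p.

Lemma section_retraction (u : {linear M -> P}) :
  cancel u p ->
  exists s : {linear P -> K}, cancel i s /\ forall x, i (s x) = x - u (p x).
Proof.
case: (ex) => i_inj _ kerp up.
have /choice[s sE] x : exists k, i k = x - u (p x).
  by apply/kerp; rewrite linearB up subrr.
have sl : linear s.
  move=> a x y; apply: i_inj.
  rewrite linearP !sE (linearP p) (linearP u) scalerBr.
  by rewrite opprD addrACA.
exists (mk_linear sl); split=> // k; apply: i_inj.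
by rewrite /= sE (short_exactE ex) linear0 subr0.
Qed.

Lemma retraction_section (s : {linear P -> K}) :
  cancel i s ->
  exists u : {linear M -> P}, cancel u p /\ forall x, u (p x) = x - i (s x).
Proof.
case: (ex) => i_inj /choice[q qE] kerp si.
(* The map [x - i (s x)] vanishes on the image of [i], so its value depends only on [p x]. Hence the
   section below does not depend on the choice of [q], which is why it is linear. *)
have uE x : q (p x) - i (s (q (p x))) = x - i (s x).
  have [|k kE] := (kerp (q (p x) - x)).1; first by rewrite linearB qE subrr.
  have -> : q (p x) = i k + x by rewrite kE subrK.
  by rewrite (linearD s) si (linearD i) opprD addrACA subrr add0r.
have ul : linear (fun m => q m - i (s (q m))).
  move=> a x y; rewrite -[in LHS](qE x) -[in LHS](qE y) -linearP uE.
  by rewrite (linearP s) (linearP i) scalerBr opprD addrACA.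
exists (mk_linear ul); split=> // m.
by rewrite /= linearB qE (short_exactE ex) subr0.
Qed.
End Exact.
End Modules.

(** * Tensoring with a right module *)

Section TensorExact.
Variables (S : pzRingType) (X : lmodType S^c).

Lemma tpureDl (Y : lmodType S) x x' (y : Y) :
  tpure (x + x' : X) y = tpure x y + tpure x' y.
Proof. by have [+ _ _] := @tpure_balanced S X Y; exact. Qed.

Lemma tpureDr (Y : lmodType S) (x : X) (y y' : Y) :
  tpure x (y + y') = tpure x y + tpure x y'.
Proof. by have [_ + _] := @tpure_balanced S X Y; exact. Qed.

Lemma tpureZ (Y : lmodType S) (s : S) (x : X) (y : Y) :
  tpure ((s : S^c) *: x) y = tpure x (s *: y).
Proof. by have [_ _ +] := @tpure_balanced S X Y; exact. Qed.

Lemma tensor_morph_ext (Y : lmodType S) (A : zmodType) (f g : tensor X Y -> A) :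
    zmod_morphism f -> zmod_morphism g ->
  (forall x y, f (tpure x y) = g (tpure x y)) -> f =1 g.
Proof.
move=> fB gB fg; elim/tensor_ind => [|u v fu fv|//].
  by rewrite !zmod_morphism0.
by rewrite fB gB fu fv.
Qed.

Definition tmap (Y Y' : lmodType S) (f : {linear Y -> Y'}) :
    tensor X Y -> tensor X Y' :=
  tensor_map (idfun : {linear X -> X}) f.
HB.instance Definition _ (Y Y' : lmodType S) (f : {linear Y -> Y'}) :=
  GRing.isZmodMorphism.Build _ _ (tmap f)
    (raddfB (tensor_map (idfun : {linear X -> X}) f)).

Lemma tmap_pure (Y Y' : lmodType S) (f : {linear Y -> Y'}) x y :
  tmap f (tpure x y) = tpure x (f y).
Proof. exact: tensor_map_pure. Qed.

Lemma tmap_comp (Y Y' Y'' : lmodType S) (f : {linear Y -> Y'})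
    (g : {linear Y' -> Y''}) t :
  tmap (g \o f : {linear Y -> Y''}) t = tmap g (tmap f t).
Proof.
move: t; apply: tensor_morph_ext => [||x y]; try by move=> u v; rewrite !raddfB.
by rewrite !tmap_pure.
Qed.

Lemma tmap0 (Y Y' : lmodType S) (f : {linear Y -> Y'}) t :
  (forall y, f y = 0) -> tmap f t = 0.
Proof.
move=> f0; move: t; apply: tensor_morph_ext => [||x y]; first exact: raddfB.
  by move=> u v; rewrite subr0.
by rewrite tmap_pure f0; apply: (addrI (tpure x 0)); rewrite -tpureDr !addr0.
Qed.

Lemma tmap_surj (Y Y' : lmodType S) (f : {linear Y -> Y'}) :
  surjective f -> surjective (tmap f).
Proof.
move=> fs; elim/tensor_ind => [|_ _ [u <-] [v <-]|x y].
- by exists 0; rewrite raddf0.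
- by exists (u - v); rewrite raddfB.
- by have [z <-] := fs y; exists (tpure x z); rewrite tmap_pure.
Qed.

Section RightExact.
Variables (K P M : lmodType S) (i : {linear K -> P}) (p : {linear P -> M}).
Hypothesis ex : short_exact i p.

Let im : pred (tensor X P) := fun t => `[< exists u, tmap i u = t >].

Let im_zmod_closed : zmod_closed im.
Proof.
split; first by apply/asboolP; exists 0; rewrite raddf0.
move=> _ _ /asboolP[u <-] /asboolP[v <-]; apply/asboolP.
by exists (u - v); rewrite raddfB.
Qed.

#[local]
HB.instance Definition _ := GRing.isZmodClosed.Build _ im im_zmod_closed.

Let coker : Type := Quotient.quot (GRing.ZmodClosed.clone _ im _).
#[local]
HB.instance Definition _ := GRing.Zmodule.on coker.

(* The inverse X (x) M -> (X (x) P) / im is x (x) m |-> [x (x) q m] for any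
   set-theoretic section q of p. *)
Lemma tmap_right_exact t : tmap p t = 0 -> exists u, tmap i u = t.
Proof.
have [_ /choice[q qE] kerp] := ex.
have coP u v : (\pi_coker u = \pi_coker v) <-> exists w, tmap i w = u - v.
  split=> [/eqP|imuv]; first by rewrite -Quotient.idealrBE => /asboolP.
  by apply/eqP; rewrite -Quotient.idealrBE; apply/asboolP.
pose f (x : X) m : coker := \pi_coker (tpure x (q m)).
have fE x y : f x (p y) = \pi_coker (tpure x y).
  apply/coP; have [|k kE] := (kerp (q (p y) - y)).1.
    by rewrite linearB qE subrr.
  exists (tpure x k); rewrite tmap_pure kE.
  by apply/eqP; rewrite eq_sym subr_eq -tpureDr subrK.
have fB : balanced f.
  split=> [x x' m|x m m'|s x m].
  - by rewrite /f tpureDl raddfD.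
  - by rewrite -[m]qE -[m']qE -linearD !fE tpureDr raddfD.
  - by rewrite -[m]qE -linearZ !fE tpureZ.
(* Consequently a [t] killed by [tmap p] has trivial class, that is, it lies in the image of
   [tmap i]. *)
have tE : tensor_lift f \o tmap p =1 \pi_coker.
  apply: tensor_morph_ext => [u v|u v|x y]; last first.
  - by rewrite /= tmap_pure (tensor_lift_pure fB) fE.
  - by rewrite raddfB.
  - by rewrite /= raddfB (tensor_lift_is_zmod_morphism fB).
move=> t0; have := tE t; rewrite /= t0.
have -> : tensor_lift f 0 = \pi_coker 0.
  by rewrite -(raddf0 (tmap p)) -tE.
by move=> /esym/coP[u uE]; exists u; rewrite uE subr0.
Qed.
End RightExact.
End TensorExact.
Arguments tmap {S} X {Y Y'} f t.

(** * Injective modules as retracts of coinduced ones *)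

Section CoinducedInjective.
Variables (S : pzRingType) (I : lmodType S^c).

(* The right S-module Hom_Z(S, I), with (f.a)(s) = f(a s). *)
Definition coind_pred : {pred S -> I} := fun f => `[< zmod_morphism f >].

Lemma coind_zmod_closed : zmod_closed coind_pred.
Proof.
split=> [|f g /asboolP fB /asboolP gB]; apply/asboolP => s t.
  by rewrite subr0.
rewrite -[LHS]/(f (s - t) - g (s - t)) fB gB.
by rewrite -[RHS]/(f s - g s - (f t - g t)) !opprD !opprK addrACA.
Qed.
HB.instance Definition _ :=
  GRing.isZmodClosed.Build _ coind_pred coind_zmod_closed.

Record coind : Type := Coind {
  coind_fun :> S -> I;
  _ : coind_fun \in coind_pred }.
HB.instance Definition _ := [isSub for coind_fun].
HB.instance Definition _ := [Choice of coind by <:].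
HB.instance Definition _ := [SubChoice_isSubZmodule of coind by <:].

Lemma coindB (f : coind) : zmod_morphism f.
Proof. by have /asboolP := valP f. Qed.

HB.instance Definition _ (f : coind) :=
  GRing.isZmodMorphism.Build S I f (coindB f).

Lemma coind_ext (f g : coind) : f =1 g -> f = g.
Proof. by move=> fg; apply/val_inj/funext. Qed.

Lemma coind_scale_subproof (a : S) (f : coind) :
  (fun s => f (a * s)) \in coind_pred.
Proof. by apply/asboolP => s t; rewrite mulrBr coindB. Qed.

Definition coind_scale (a : S^c) (f : coind) : coind :=
  Coind (coind_scale_subproof a f).

Lemma coind_scaleA a b f :
  coind_scale a (coind_scale b f) = coind_scale (a * b) f.
Proof. by apply: coind_ext => s /=; rewrite mulrA. Qed.

Lemma coind_scale1 : left_id 1 coind_scale.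
Proof. by move=> f; apply: coind_ext => s /=; rewrite mul1r. Qed.

Lemma coind_scaleDr : right_distributive coind_scale +%R.
Proof. by move=> a f g; apply: coind_ext. Qed.

Lemma coind_scaleDl f : {morph coind_scale^~ f : a b / a + b}.
Proof.
move=> a b; apply: coind_ext => s.
by rewrite -[LHS]/(f (((a : S) + b) * s)) mulrDl raddfD.
Qed.

HB.instance Definition _ := GRing.Zmodule_isLmodule.Build S^c coind
  coind_scaleA coind_scale1 coind_scaleDr coind_scaleDl.

(** The map x |-> (s |-> x.s) embeds [I] in Hom_Z(S, I), since evaluation at 1 recovers x; extending
    the identity of [I] along it gives [r]. *)
Lemma coind_retraction : injective_module I ->
  exists r : {linear coind -> I}, forall (f : coind) x,
    (forall s, f s = (s : S^c) *: x) -> r f = x.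
Proof.
move=> injI.
have cP x : (fun s : S => (s : S^c) *: x) \in coind_pred.
  by apply/asboolP => s t; rewrite scalerBl.
have cl : linear (fun x => Coind (cP x)).
  move=> a x y; apply: coind_ext => s.
  rewrite [RHS](_ : _ = ((a : S) * s : S^c) *: x + (s : S^c) *: y) //=.
  by rewrite scalerDr scalerA.
have [|r rE] := injI _ _ (mk_linear cl) (idfun : {linear I -> I}).
  by move=> x y /(congr1 (fun f : coind => f 1)) /=; rewrite !scale1r.
by exists r => f x fE; rewrite -[RHS]rE; congr (r _); apply: coind_ext.
Qed.
End CoinducedInjective.

(** * Diagonal tensor products *)

Section GroupRingModules.
Variables (R : comPzRingType) (G : groupType).
Local Notation RG := (group_ring R G).
Local Notation "''d' r g" := (gr_delta r g : RG)
  (at level 10, r at level 8, g at level 8).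
Implicit Types (r : R) (g : G) (a b : RG) (M N A C : lmodType RG).

Lemma gr_ind (P : RG -> Prop) :
    P 0 -> (forall a b, P a -> P b -> P (a + b)) ->
  (forall r g, P ('d r g)) -> forall a, P a.
Proof.
move=> P0 PD Pd a.
have -> : a = \sum_(g <- gr_fsupp a) 'd (a g : R) g.
  apply: gr_ext => x.
  rewrite (@big_morph _ _ (fun b : RG => b x) 0 +%R 0 +%R) //=.
  rewrite /gr_delta_fun.
  have [xa|xa] := boolP (x \in gr_fsupp a).
    rewrite (bigD1_seq x) ?fset_uniq //= eqxx big1 ?addr0// => y.
    by rewrite eq_sym => /negPf ->.
  rewrite (gr_fsuppP xa) big_seq big1 // => y ya.
  by case: eqP => // xy; rewrite xy ya in xa.
by elim/big_rec: _ => // g b _; exact: PD.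
Qed.

Lemma gr_linear M N (f : M -> N) :
    zmod_morphism f -> (forall r g x, f ('d r g *: x) = 'd r g *: f x) ->
  linear f.
Proof.
move=> fB fd.
have fD := zmod_morphismD fB.
move=> a x y; rewrite fD; congr (_ + _).
elim/gr_ind: a => [|a b IHa IHb|r g]; last exact: fd.
  by rewrite !scale0r zmod_morphism0.
by rewrite !scalerDl fD IHa IHb.
Qed.

Lemma gr_deltaK g M :
  cancel (fun x : M => 'd 1 g *: x) (fun x => 'd 1 g^-1%g *: x).
Proof. by move=> x; rewrite scalerA gr_deltaM mulr1 mulVg scale1r. Qed.

Lemma gr_deltaKV g M :
  cancel (fun x : M => 'd 1 g^-1%g *: x) (fun x => 'd 1 g *: x).
Proof. by move=> x; rewrite scalerA gr_deltaM mulr1 mulgV scale1r. Qed.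

Lemma gr_deltaE r g M (x : M) : 'd r g *: x = 'd r 1%g *: ('d 1 g *: x).
Proof. by rewrite scalerA gr_deltaM mulr1 mul1g. Qed.

Lemma gr_delta1C r g M (x : M) :
  'd r 1%g *: ('d 1 g *: x) = 'd 1 g *: ('d r 1%g *: x).
Proof. by rewrite !scalerA !gr_deltaM !mulr1 !mul1r !mulg1 !mul1g. Qed.

Lemma grmod_deltaE (V : lmodType R) (act : gaction G V) r g (v : grmod act) :
  'd r g *: v = r *: (act g v : V).
Proof. exact: gr_sum_delta. Qed.

Section Restrict.
Variables (M N : lmodType RG) (f : {linear M -> N}).

Lemma resmap_linear : linear (f : resmod M -> resmod N).
Proof. by move=> r x y; exact: linearP. Qed.

Definition resmap : {linear resmod M -> resmod N} := mk_linear resmap_linear.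
End Restrict.

Lemma res_linear M N (f : M -> N) :
    zmod_morphism f -> (forall r x, f ('d r 1%g *: x) = 'd r 1%g *: f x) ->
  linear (f : resmod M -> resmod N).
Proof.
move=> fB fd r x y.
by rewrite -[LHS]/(f ('d r 1%g *: (x : M) + y)) (zmod_morphismD fB) fd.
Qed.

Lemma res_deltaE M N (f : {linear resmod M -> resmod N}) r x :
  f ('d r 1%g *: (x : M)) = 'd r 1%g *: (f x : N).
Proof. exact: (linearZ_LR f r (x : resmod M)). Qed.

Section DiagonalTensor.
Variables (M N : lmodType RG).
Local Notation MN := (diag_tensor M N).

Definition dpure (x : M) (y : N) : MN :=
  cpure (x : resmod M) (y : resmod N).

Lemma dpureDl x x' y : dpure (x + x') y = dpure x y + dpure x' y.
Proof. exact: cpureDl. Qed.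

Lemma dpureDr x y y' : dpure x (y + y') = dpure x y + dpure x y'.
Proof. exact: cpureDr. Qed.

Lemma dpureZ r x y : dpure ('d r 1%g *: x) y = dpure x ('d r 1%g *: y).
Proof. exact: cpureZ. Qed.

(** The group element acts on both factors, but the coefficient [r] only once; it is put on the
    first factor. *)
Lemma dpure_delta r g x y :
  'd r g *: dpure x y = dpure ('d r g *: x) ('d 1 g *: y).
Proof.
transitivity (r *: diag_act M N g (cpure (x : resmod M) (y : resmod N))).
  exact: grmod_deltaE.
rewrite diag_act_pure cscale_pure.
by congr cpure; rewrite [RHS]gr_deltaE.
Qed.

Lemma diag_ind (P : MN -> Prop) :
    P 0 -> (forall u v, P u -> P v -> P (u - v)) ->
  (forall x y, P (dpure x y)) -> forall t, P t.
Proof. exact: ctensor_ind. Qed.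

Lemma diag_morph_ext (A : zmodType) (f g : MN -> A) :
    zmod_morphism f -> zmod_morphism g ->
  (forall x y, f (dpure x y) = g (dpure x y)) -> f =1 g.
Proof. exact: tensor_morph_ext. Qed.

Definition dbalanced (A : zmodType) (f : M -> N -> A) : Prop :=
  [/\ forall x x' y, f (x + x') y = f x y + f x' y,
      forall x y y', f x (y + y') = f x y + f x y'
    & forall r x y, f ('d r 1%g *: x) y = f x ('d r 1%g *: y)].

Definition dlift (A : zmodType) (f : M -> N -> A) : MN -> A :=
  @tensor_lift R (rightmod (resmod M)) (resmod N) A f.

Section Lift.
Variables (A : zmodType) (f : M -> N -> A).
Hypothesis fB : dbalanced f.

Let fB' : @balanced R (rightmod (resmod M)) (resmod N) A f.
Proof. exact: fB. Qed.

Lemma dliftB : zmod_morphism (dlift f).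
Proof. exact: tensor_lift_is_zmod_morphism fB'. Qed.

Lemma dlift_pure x y : dlift f (dpure x y) = f x y.
Proof. exact: tensor_lift_pure fB' _ _. Qed.
End Lift.

(** The pair [r], [g] is fixed so that the case g = 1 also serves for maps that are R-linear without
    being G-equivariant. *)
Lemma dlift_delta A (f : M -> N -> A) r g : dbalanced f ->
    (forall x y, f ('d r g *: x) ('d 1 g *: y) = 'd r g *: f x y) ->
  forall t, dlift f ('d r g *: t) = 'd r g *: dlift f t.
Proof.
move=> fB fd; apply: diag_morph_ext => [u v|u v|x y]; last first.
- by rewrite dpure_delta !dlift_pure.
- by rewrite (dliftB fB) scalerBr.
- by rewrite scalerBr (dliftB fB).
Qed.

Lemma dlift_linear A (f : M -> N -> A) : dbalanced f ->
    (forall r g x y, f ('d r g *: x) ('d 1 g *: y) = 'd r g *: f x y) ->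
  linear (dlift f).
Proof.
move=> fB fd; apply: gr_linear (dliftB fB) _ => r g t.
exact: dlift_delta.
Qed.
End DiagonalTensor.

Section DiagonalMap.
Variables (M M' N : lmodType RG) (f : {linear M -> M'}).

Let f_balanced : dbalanced (fun x (y : N) => dpure (f x) y).
Proof.
split=> [x x' y|x y y'|r x y].
- by rewrite linearD dpureDl.
- by rewrite dpureDr.
- by rewrite linearZ dpureZ.
Qed.

Let f_equivariant r g x (y : N) :
  dpure (f ('d r g *: x)) ('d 1 g *: y) = 'd r g *: dpure (f x) y.
Proof. by rewrite linearZ dpure_delta. Qed.

Definition diag_map : {linear diag_tensor M N -> diag_tensor M' N} :=
  mk_linear (dlift_linear f_balanced f_equivariant).

Lemma diag_map_pure x y : diag_map (dpure x y) = dpure (f x) y.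
Proof. exact: dlift_pure f_balanced _ _. Qed.

Lemma diag_map_surj : surjective f -> surjective diag_map.
Proof.
move=> fs; elim/diag_ind => [|_ _ [u <-] [v <-]|x y].
- by exists 0; rewrite linear0.
- by exists (u - v); rewrite linearB.
- by have [z <-] := fs x; exists (dpure z y); rewrite diag_map_pure.
Qed.
End DiagonalMap.

Section DiagonalExact.
Variables (K P M N : lmodType RG) (i : {linear K -> P}) (p : {linear P -> M}).
Hypothesis ex : short_exact i p.

(** A splitting over R suffices: it provides [s] and [u] with i s + u p = 1, and this identity
    survives tensoring with [N]. The tensored maps need only be additive, as exactness concerns the
    underlying groups. *)
Lemma diag_map_exact (s : {linear resmod P -> resmod K}) :
  cancel i s -> short_exact (diag_map N i) (diag_map N p).
Proof.
move=> si; have [i_inj p_surj kerp] := ex.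
have rex : short_exact (resmap i) (resmap p) by [].
have [u [_ uE]] := retraction_section rex si.
have sB : dbalanced (fun x (y : N) => dpure (s x : K) y).
  split=> [x x' y|x y y'|r x y].
  - by rewrite (linearD s) dpureDl.
  - by rewrite dpureDr.
  - by rewrite res_deltaE dpureZ.
have uB : dbalanced (fun x (y : N) => dpure (u x : P) y).
  split=> [x x' y|x y y'|r x y].
  - by rewrite (linearD u) dpureDl.
  - by rewrite dpureDr.
  - by rewrite res_deltaE dpureZ.
split.
- apply: (@can_inj _ _ _ (dlift (fun x (y : N) => dpure (s x : K) y))).
  apply: diag_morph_ext => [u' v|//|x y].
    by rewrite linearB (dliftB sB).
  by rewrite diag_map_pure (dlift_pure sB) si.
- exact: diag_map_surj.
- move=> t; split=> [pt|[v <-]]; last first.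
    elim/diag_ind: v => [|v w vE wE|x y]; rewrite ?linear0//.
      by rewrite !linearB vE wE subrr.
    rewrite !diag_map_pure (short_exactE ex).
    by apply: (addrI (dpure 0 y)); rewrite -dpureDl !addr0.
  exists (dlift (fun x (y : N) => dpure (s x : K) y) t).
  suff tE : diag_map N i (dlift (fun x (y : N) => dpure (s x : K) y) t) +
      dlift (fun x (y : N) => dpure (u x : P) y) (diag_map N p t) = t.
    by rewrite -[RHS]tE pt (zmod_morphism0 (dliftB uB)) addr0.
  move: t {pt}; apply: diag_morph_ext => [v w|//|x y].
    by rewrite (dliftB sB) !linearB (dliftB uB) opprD addrACA.
  rewrite (dlift_pure sB) !diag_map_pure (dlift_pure uB) -dpureDl.
  by rewrite [u _]uE addrC subrK.
Qed.
End DiagonalExact.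
End GroupRingModules.

(** * Projectivity of tensor products *)

Section Restriction.
Variables (R : comPzRingType) (G : groupType).
Local Notation RG := (group_ring R G).
Local Notation "''d' r g" := (gr_delta r g : RG)
  (at level 10, r at level 8, g at level 8).

Section FunctionModule.
Variable A : lmodType R.

Definition rshift (g : G) (f : G -> A) : G -> A := fun x => f (x * g)%g.

Lemma rshift_linear g : linear (rshift g).
Proof. by []. Qed.
HB.instance Definition _ g :=
  GRing.isLinear.Build R (G -> A) (G -> A) _ (rshift g) (rshift_linear g).

Lemma rshift1 f : rshift 1 f = f.
Proof. by apply/funext => x; rewrite /rshift mulg1. Qed.

Lemma rshiftM g h f : rshift (g * h)%g f = rshift g (rshift h f).
Proof. by apply/funext => x; rewrite /rshift mulgA. Qed.

(* The RG-module coinduced from A. *)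
Definition funmod : lmodType RG :=
  grmod (@GAction R G (G -> A) rshift rshift1 rshiftM).

Lemma funmod_deltaE r g (f : funmod) x : ('d r g *: f) x = r *: f (x * g)%g.
Proof. by rewrite grmod_deltaE. Qed.
End FunctionModule.

(** Restriction to R is left adjoint to the coinduction [funmod], and coinduction preserves
    surjections. The adjoint of [f] is y |-> (x |-> f (x y)). *)
Lemma projective_res (P : lmodType RG) : projective P -> projective (resmod P).
Proof.
move=> prP A C q f qs.
have ql : linear (fun u : funmod A => (q \o u : funmod C)).
  apply: gr_linear => [u v|r g u]; apply/funext => x; first exact: linearB.
  by rewrite funmod_deltaE /= funmod_deltaE linearZ.
have fl : linear (fun y : P => (fun x => f ('d 1 x *: y)) : funmod C).
  apply: gr_linear => [u v|r g u]; apply/funext => x.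
    by rewrite scalerBr; exact: (linearB f).
  rewrite funmod_deltaE -linearZ; congr (f _).
  rewrite -[RHS]/('d r 1%g *: ('d 1 (x * g)%g *: u)) !scalerA !gr_deltaM.
  by rewrite mulr1 mul1r mul1g.
have [|h hE] := prP _ _ (mk_linear ql) (mk_linear fl).
  move=> u; have /choice[v vE] x : exists a, q a = u x by exact: qs.
  by exists v; apply/funext.
(* Evaluation at the identity, the counit of the adjunction, turns the RG-lift into an R-linear
   one. *)
have hl : linear (fun y : resmod P => (h y : funmod A) 1%g).
  move=> r x y.
  rewrite (_ : h _ = 'd r 1%g *: h x + h y); last exact: linearP.
  rewrite -[LHS]/(('d r 1%g *: h x) 1%g + h y 1%g) funmod_deltaE.
  by rewrite mulg1.
exists (mk_linear hl) => y.
have /(congr1 (fun u : funmod C => u 1%g)) /= -> := hE y.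
by rewrite scale1r.
Qed.
End Restriction.

(** * Internal Hom and iterated tensor products *)

Section InternalHom.
Variables (R : comPzRingType) (G : groupType).
Local Notation RG := (group_ring R G).
Local Notation "''d' r g" := (gr_delta r g : RG)
  (at level 10, r at level 8, g at level 8).

Section HomModule.
Variables Y A : lmodType RG.

Definition hom_pred : {pred resmod Y -> resmod A} := fun f => `[< linear f >].
Lemma hom_submod_closed : submod_closed hom_pred.
Proof.
split=> [|r f h /asboolP fl /asboolP hl]; apply/asboolP => s x y.
  by rewrite -[RHS]/(s *: 0 + 0) scaler0 addr0.
rewrite -[LHS]/(r *: f (s *: x + y) + h (s *: x + y)) fl hl.
rewrite -[RHS]/(s *: (r *: f x + h x) + (r *: f y + h y)).
by rewrite !scalerDr !scalerA [s * r]mulrC addrACA.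
Qed.
HB.instance Definition _ := GRing.isSubmodClosed.Build R (resmod Y -> resmod A)
  hom_pred hom_submod_closed.

Definition hom_fun (f : submod hom_pred) : Y -> A := submod_val f.

Lemma hom_linear f : linear (hom_fun f : resmod Y -> resmod A).
Proof. exact/asboolP/(valP f). Qed.

Lemma hom_act_subproof (g : G) (f : submod hom_pred) :
  (fun y : resmod Y =>
      'd 1 g *: (hom_fun f ('d 1 g^-1%g *: y : Y) : A) : resmod A)
    \in hom_pred.
Proof.
apply/asboolP => s x y; have fl := hom_linear f.
have -> : 'd 1 g^-1%g *: (s *: x + y : Y)
    = s *: ('d 1 g^-1%g *: (x : Y) : resmod Y) + 'd 1 g^-1%g *: (y : Y).
  by rewrite [LHS]scalerDr; congr (_ + _); exact/esym/gr_delta1C.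
rewrite [X in _ *: X]fl [LHS]scalerDr; congr (_ + _).
exact/esym/gr_delta1C.
Qed.

Definition hom_act (g : G) (f : submod hom_pred) : submod hom_pred :=
  Submod (hom_act_subproof g f).

Lemma hom_act_linear g : linear (hom_act g).
Proof.
move=> r u v; apply/val_inj/funext => y.
rewrite [LHS]scalerDr; congr (_ + _).
exact/esym/gr_delta1C.
Qed.
HB.instance Definition _ g := GRing.isLinear.Build R _ _ _
  (hom_act g) (hom_act_linear g).

Lemma hom_act1 f : hom_act 1%g f = f.
Proof.
by apply/val_inj/funext => y /=; rewrite invg1 !(@scale1r RG).
Qed.

Lemma hom_actM g h f : hom_act (g * h)%g f = hom_act g (hom_act h f).
Proof.
apply/val_inj/funext => y /=.
by rewrite !scalerA !gr_deltaM !mulr1 invgM.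
Qed.

(* Hom_R(Y, A) with the conjugation action (g f)(y) = g f(g^-1 y). *)
Definition hommod : lmodType RG :=
  grmod (@GAction R G (submod hom_pred) hom_act hom_act1 hom_actM).

Lemma mk_hom_subproof (f : {linear resmod Y -> resmod A}) :
  (f : resmod Y -> resmod A) \in hom_pred.
Proof. exact/asboolP/linearP. Qed.

Definition mk_hom (f : {linear resmod Y -> resmod A}) : hommod :=
  Submod (mk_hom_subproof f).

Lemma hom_deltaE r g (f : hommod) y :
  hom_fun ('d r g *: f) y = 'd r g *: hom_fun f ('d 1 g^-1%g *: y).
Proof. by rewrite [RHS]gr_deltaE grmod_deltaE. Qed.

Lemma hom_ext (f h : hommod) : hom_fun f =1 hom_fun h -> f = h.
Proof. by move=> fh; apply/val_inj/funext. Qed.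

End HomModule.

(* An RG-map (M (x) X) (x) Y -> C is an RG-map F : M (x) X -> Hom_R(Y, C).
   Composition with a surjection A -> C need not map Hom_R(Y, A) onto
   Hom_R(Y, C), but its image contains that of F: for fixed x, the
   R-projectivity of M (x) Y lifts m (x) y |-> F(m (x) x)(y) to A. *)
Lemma projective_diag_tensor2 (M X Y : lmodType RG) :
    projective (diag_tensor M X) -> projective (resmod (diag_tensor M Y)) ->
  projective (diag_tensor (diag_tensor M X) Y).
Proof.
move=> prMX prMY A C q f qs.
have fl w : linear (fun y : resmod Y => f (dpure w y) : resmod C).
  move=> r x y; rewrite -[RHS]/('d r 1%g *: f (dpure w x) + f (dpure w y)).
  rewrite -linearP; congr (f _).
  rewrite [dpure w _]dpureDr; congr (_ + _).
  by rewrite dpure_delta scale1r [LHS](_ : _ = dpure w ('d r 1%g *: x)) ?dpureZ.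
have f'l : linear (fun w => mk_hom (mk_linear (fl w))).
  apply: gr_linear => [u v|r g w]; apply: hom_ext => y.
    rewrite -[RHS]/(f (dpure u y) - f (dpure v y)) -linearB; congr (f _).
    by apply/eqP; rewrite eq_sym subr_eq -dpureDl subrK.
  rewrite hom_deltaE -linearZ; congr (f _).
  by rewrite dpure_delta gr_deltaKV.
have q'l : linear (fun u : hommod Y A => mk_hom
    (resmap q \o mk_linear (hom_linear u) : {linear resmod Y -> resmod C})).
  apply: gr_linear => [u v|r g u]; apply: hom_ext => y; first exact: linearB.
  by rewrite hom_deltaE -linearZ -hom_deltaE.
have im w : exists u, mk_linear q'l u = mk_linear f'l w.
  (* The elements with a liftable image form a subgroup, so pure tensors are enough. *)
  elim/diag_ind: w => [|v w [a aE] [b bE]|m x].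
  - by exists 0; rewrite !linear0.
  - by exists (a - b); rewrite !linearB aE bE.
  pose F m' y := f (dpure (dpure m' x) y).
  have FB : dbalanced F.
    rewrite /F; split=> [m' m'' y|m' y y'|r m' y].
    - by rewrite -linearD !dpureDl.
    - by rewrite -linearD dpureDr.
    - rewrite -dpureZ dpure_delta.
      by rewrite scale1r.
  (* Since [x] is held fixed while G would move it, only R-linearity can be claimed here, and
     R-projectivity of M (x) Y is all that is used. *)
  have Fl : linear (dlift F : resmod (diag_tensor M Y) -> resmod C).
    apply: res_linear (dliftB FB) _ => r; apply: dlift_delta => // m' y.
    by rewrite /F -linearZ !dpure_delta !scale1r.
  have [h hE] := prMY _ _ (resmap q) (mk_linear Fl) qs.
  have hl : linear (fun y : resmod Y => h (dpure m y) : resmod A).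
    apply: res_linear => [u v|r y].
      rewrite -(linearB h); congr (h _).
      by apply/eqP; rewrite eq_sym subr_eq -dpureDr subrK.
    rewrite -res_deltaE; congr (h _).
    by rewrite dpure_delta scale1r dpureZ.
  exists (mk_hom (mk_linear hl)); apply: hom_ext => y.
  by rewrite -[LHS]/(q (h (dpure m y))) hE; exact: dlift_pure.
have [h hE] := projective_lift prMX im.
have hB : dbalanced (fun w y => hom_fun (h w) y).
  split=> [w w' y|w y y'|r w y].
  - by rewrite linearD.
  - exact: (linearD (mk_linear (hom_linear (h w)))).
  - rewrite linearZ hom_deltaE invg1 scale1r.
    exact/esym/(res_deltaE (mk_linear (hom_linear (h w)))).
have hd r g w y :
    hom_fun (h ('d r g *: w)) ('d 1 g *: y) = 'd r g *: hom_fun (h w) y.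
  by rewrite linearZ hom_deltaE gr_deltaK.
exists (mk_linear (dlift_linear hB hd)); apply: diag_morph_ext => [u v|u v|w y].
- by rewrite !linearB.
- exact: linearB.
rewrite /= dlift_pure //; have /(congr1 (fun u => hom_fun u y)) := hE w.
exact.
Qed.
End InternalHom.

(** * Cofibrant modules *)

Section Cofibrant.
Variables (R : comPzRingType) (G : groupType).
Local Notation RG := (group_ring R G).
Local Notation "''d' r g" := (gr_delta r g : RG)
  (at level 10, r at level 8, g at level 8).
Local Notation B := (BGR R G).
Implicit Types (r : R) (g : G) (M N A C : lmodType RG).

(** * The tensor product with RG as an induced module *)

Section RegularTensor.
Variable M : lmodType RG.
Local Notation MRG := (diag_tensor M RG^o).
Implicit Types m : M.

(** The untwisting of the diagonal action: m (x) g = g (g^-1 m (x) 1), so the elements m (x) 1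
    generate M (x) RG over RG. *)
Lemma dpure_regular m r g :
  dpure m ('d r g : RG^o) = 'd r g *: dpure ('d 1 g^-1%g *: m) (1 : RG^o).
Proof.
rewrite dpure_delta !scalerA gr_deltaM mulr1 mulgV dpureZ scalerA gr_deltaM.
by rewrite mulr1 mul1g; congr (dpure _ _); exact/esym/mulr1.
Qed.

Lemma regular_tensor_ext A (f f' : {linear MRG -> A}) :
  (forall m, f (dpure m (1 : RG^o)) = f' (dpure m (1 : RG^o))) -> f =1 f'.
Proof.
move=> ff'; apply: diag_morph_ext => [u v|u v|m a]; try exact: linearB.
elim/gr_ind: a => [|a b IHa IHb|r g].
- suff -> : dpure m (0 : RG^o) = 0 by rewrite !linear0.
  by apply: (addrI (dpure m (0 : RG^o))); rewrite -dpureDr !addr0.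
- by rewrite dpureDr !linearD IHa IHb.
- by rewrite dpure_regular !linearZ ff'.
Qed.

Section Lift.
Variables (A : lmodType RG) (h : {linear resmod M -> resmod A}).

(** By [dpure_regular], an RG-map with m (x) 1 |-> h m must send m (x) g to g h(g^-1 m). The sum is
    formed in [resmod A] because [gr_sum] takes values in an R-module. *)
Definition regular_lift_fun (m : M) (a : RG^o) : A :=
  gr_sum a (fun g => 'd 1 g *: (h ('d 1 g^-1%g *: m) : A) : resmod A).

Lemma regular_lift_fun_delta m r g :
  regular_lift_fun m ('d r g) = 'd r g *: (h ('d 1 g^-1%g *: m) : A).
Proof. by rewrite [RHS]gr_deltaE /regular_lift_fun gr_sum_delta. Qed.

Lemma regular_lift_funDr m a b :
  regular_lift_fun m (a + b) = regular_lift_fun m a + regular_lift_fun m b.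
Proof. by rewrite /regular_lift_fun gr_sumDl. Qed.

Lemma regular_lift_fun0 m : regular_lift_fun m 0 = 0.
Proof.
by apply: (addrI (regular_lift_fun m 0)); rewrite -regular_lift_funDr !addr0.
Qed.

Lemma regular_lift_fun_equivariant r g m a :
  regular_lift_fun ('d r g *: m) ('d 1 g *: a) = 'd r g *: regular_lift_fun m a.
Proof.
elim/gr_ind: a => [|a b IHa IHb|s k].
- by rewrite scaler0 !regular_lift_fun0 scaler0.
- by rewrite scalerDr !regular_lift_funDr IHa IHb scalerDr.
have -> : 'd 1 g *: ('d s k : RG^o) = 'd s (g * k)%g.
  by rewrite [LHS]gr_deltaM mul1r.
rewrite !regular_lift_fun_delta scalerA gr_deltaM mul1r.
rewrite invgM -mulgA mulVg mulg1.
rewrite [X in h X]gr_deltaE res_deltaE !scalerA !gr_deltaM.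
by rewrite mulg1 mulrC.
Qed.

Lemma regular_lift_fun_balanced : dbalanced regular_lift_fun.
Proof.
split=> [m m' a|m a b|r m a]; last 2 first.
- exact: regular_lift_funDr.
(* The unit of RG is the delta at the identity, so writing [a] as 1 a makes equivariance at g = 1
   applicable. *)
- rewrite -[in LHS](scale1r a) regular_lift_fun_equivariant.
  elim/gr_ind: a => [|a b IHa IHb|s k].
  + by rewrite scaler0 !regular_lift_fun0 scaler0.
  + by rewrite scalerDr !regular_lift_funDr -IHa -IHb scalerDr.
  rewrite regular_lift_fun_delta scalerA gr_deltaM mul1g.
  have -> : 'd r 1%g *: ('d s k : RG^o) = 'd (r * s) k.
    by rewrite [LHS]gr_deltaM mul1g.
  by rewrite regular_lift_fun_delta.
- pose F n : G -> resmod A := fun g => 'd 1 g *: (h ('d 1 g^-1%g *: n) : A).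
  rewrite -[LHS]/(gr_sum a (F (m + m'))).
  rewrite -[RHS]/(gr_sum a (F m) + gr_sum a (F m')) -gr_sumDr.
  apply: congr1; apply/funext => g.
  by rewrite /F scalerDr (linearD h) scalerDr.
Qed.

Definition regular_lift : {linear MRG -> A} :=
  mk_linear (dlift_linear regular_lift_fun_balanced
    regular_lift_fun_equivariant).

Lemma regular_lift_pure m : regular_lift (dpure m (1 : RG^o)) = h m.
Proof.
rewrite /= dlift_pure; last exact: regular_lift_fun_balanced.
by rewrite [LHS]regular_lift_fun_delta invg1 !scale1r.
Qed.
End Lift.

Lemma regular_section_linear :
  linear ((fun m => dpure m (1 : RG^o)) : resmod M -> resmod MRG).
Proof.
apply: res_linear => [x y|r x].
  by apply/eqP; rewrite eq_sym subr_eq -dpureDl subrK.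
by rewrite dpure_delta scale1r.
Qed.

(** M (x) RG is induced from the restriction of [M]: RG-maps out of it correspond to R-maps out of
    [resmod M], and restriction preserves surjections. *)
Lemma projective_regular_tensor : projective (resmod M) -> projective MRG.
Proof.
move=> prM A C q f qs.
have fl : linear ((fun m => f (dpure m (1 : RG^o))) : resmod M -> resmod C).
  by move=> r x y; rewrite regular_section_linear; exact: (linearP (resmap f)).
have [h hE] := prM _ _ (resmap q) (mk_linear fl) qs.
exists (regular_lift h).
have ql : linear (fun t => q (regular_lift h t)).
  by move=> a x y; rewrite !linearP.
apply: (regular_tensor_ext (f := mk_linear ql)) => m.
exact: etrans (congr1 q (regular_lift_pure h m)) (hE m).
Qed.
End RegularTensor.

(** * Unit and multiplication of B *)

Section BoundedFunctions.

Definition bf (b : B) (x : G) : R := bf_fun (b : bounded_fun R G) x.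

Lemma bf_ext (b c : B) : bf b =1 bf c -> b = c.
Proof. by move=> bc; apply/val_inj/funext. Qed.

Lemma bf_deltaE r g (b : B) x : bf ('d r g *: b) x = r * bf b (g^-1 * x)%g.
Proof. by rewrite grmod_deltaE. Qed.

Lemma bone_subproof : @finite_range R G (fun=> 1).
Proof.
apply/asboolP/(@sub_finite_set _ _ [set 1]%classic); last exact: finite_set1.
by move=> _ [x _ <-].
Qed.
Definition bone : B := BoundedFun bone_subproof.

Lemma bone_delta g : 'd 1 g *: bone = bone.
Proof. by apply: bf_ext => x; rewrite bf_deltaE mul1r. Qed.

Lemma bmul_subproof (b c : B) : @finite_range R G (fun x => bf b x * bf c x).
Proof.
have /asboolP fb := valP (b : bounded_fun R G).
have /asboolP fc := valP (c : bounded_fun R G).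
apply/asboolP/(@sub_finite_set _ _
  ((fun p : R * R => p.1 * p.2) @` (range (bf b) `*` range (bf c)))%classic).
  by move=> _ [x _ <-]; exists (bf b x, bf c x) => //; split; exists x.
exact/finite_image/finite_setX.
Qed.
Definition bmul (b c : B) : B := BoundedFun (bmul_subproof b c).

Lemma bmulDl b b' c : bmul (b + b') c = bmul b c + bmul b' c.
Proof. by apply: bf_ext => x; exact: mulrDl. Qed.

Lemma bmulDr b c c' : bmul b (c + c') = bmul b c + bmul b c'.
Proof. by apply: bf_ext => x; exact: mulrDr. Qed.

Lemma bmul_delta r s g b c :
  bmul ('d r g *: b) ('d s g *: c) = 'd (r * s) g *: bmul b c.
Proof.
apply: bf_ext => x; rewrite bf_deltaE -[LHS]/(bf _ x * bf _ x) !bf_deltaE.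
by rewrite mulrACA.
Qed.

Lemma bmul1 b : bmul bone b = b.
Proof. by apply: bf_ext => x; exact: mul1r. Qed.
End BoundedFunctions.

Section TensorB.
Variable M : lmodType RG.
Local Notation MB := (diag_tensor M B).

Lemma bunit_linear : linear (fun m : M => dpure m bone).
Proof.
apply: gr_linear => [x y|r g x].
  by apply/eqP; rewrite eq_sym subr_eq -dpureDl subrK.
by rewrite dpure_delta bone_delta.
Qed.
Definition bunit : {linear M -> MB} := mk_linear bunit_linear.

(** Evaluation at the identity of G. It splits [bunit] over R only, being in general not
    G-equivariant; this is the kind of splitting [diag_map_exact] asks for. *)
Definition beval_fun (m : M) (b : B) : M := 'd (bf b 1%g) 1%g *: m.

Lemma beval_balanced : dbalanced beval_fun.
Proof.
rewrite /beval_fun; split=> [m m' b|m b b'|r m b]; first exact: scalerDr.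
  by rewrite -scalerDl -gr_deltaD.
by rewrite bf_deltaE invg1 mul1g scalerA gr_deltaM mulg1 mulrC.
Qed.

Lemma beval_linear : linear (dlift beval_fun : resmod MB -> resmod M).
Proof.
apply: res_linear (dliftB beval_balanced) _ => r.
apply: dlift_delta => [|m b]; first exact: beval_balanced.
rewrite /beval_fun bf_deltaE invg1 mul1g mul1r !scalerA !gr_deltaM.
by rewrite mulrC.
Qed.
Definition beval : {linear resmod MB -> resmod M} := mk_linear beval_linear.

Lemma beval_pure m b : beval (dpure m b) = 'd (bf b 1%g) 1%g *: m.
Proof. exact: dlift_pure beval_balanced _ _. Qed.

Lemma bunitK : cancel bunit beval.
Proof. by move=> m; rewrite beval_pure scale1r. Qed.

Lemma bmult1_balanced (c : B) :
  dbalanced (fun (m : M) (b : B) => dpure m (bmul b c)).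
Proof.
split=> [m m' b|m b b'|r m b]; first exact: dpureDl.
  by rewrite bmulDl dpureDr.
rewrite dpureZ -[c in RHS]scale1r bmul_delta.
by rewrite mulr1.
Qed.

(** The multiplication of B on M (x) B (x) B is lifted in two stages: first over m (x) b with [c]
    fixed, then over the outer tensor product. *)
Definition bmult_fun (t : MB) (c : B) : MB :=
  dlift (fun m b => dpure m (bmul b c)) t.

Lemma bmult_balanced : dbalanced bmult_fun.
Proof.
rewrite /bmult_fun; have dB c := dliftB (bmult1_balanced c).
have dp c := dlift_pure (bmult1_balanced c).
split=> [t t' c|t c c'|r t c].
- exact: zmod_morphismD (dB c) t t'.
- apply/eqP; rewrite -subr_eq; apply/eqP; move: t; apply: diag_morph_ext.
  + by move=> u v /=; rewrite !dB opprD addrACA opprD.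
  + exact: dB.
  by move=> m b; rewrite !dp bmulDr dpureDr addrK.
- move: t; apply: diag_morph_ext => [u v|u v|m b].
  + by rewrite scalerBr dB.
  + exact: dB.
  by rewrite dpure_delta !dp scale1r dpureZ -[b in RHS]scale1r bmul_delta mul1r.
Qed.

Lemma bmult_linear : linear (dlift bmult_fun).
Proof.
apply: dlift_linear bmult_balanced _ => r g t c; rewrite /bmult_fun.
have dB c' := dliftB (bmult1_balanced c').
move: t; apply: diag_morph_ext => [u v|u v|m b].
- by rewrite scalerBr dB.
- by rewrite dB scalerBr.
rewrite dpure_delta !(dlift_pure (bmult1_balanced _)) dpure_delta.
by rewrite bmul_delta mulr1.
Qed.

Definition bmult : {linear diag_tensor MB B -> MB} := mk_linear bmult_linear.

Lemma bunit_bmult : cancel (diag_map B bunit) bmult.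
Proof.
apply: diag_morph_ext => [u v|//|m b]; first by rewrite !linearB.
rewrite diag_map_pure /= dlift_pure; last exact: bmult_balanced.
by rewrite /bmult_fun (dlift_pure (bmult1_balanced b)) bmul1.
Qed.

End TensorB.

(* The coboundary m (x) b |-> m (x) b (x) 1 - m (x) 1 (x) b, whose image is
   isomorphic to M (x) (B / R). *)
Lemma bcobound_linear M :
  linear (fun t => bunit (diag_tensor M B) t - diag_map B (bunit M) t).
Proof.
by move=> a t u; rewrite (linearP (bunit _)) (linearP (diag_map _ _)) opprD
  addrACA scalerBr.
Qed.
Definition bcobound M := mk_linear (@bcobound_linear M).

Lemma bcobound_exact M : short_exact (bunit M) (to_im (bcobound M)).
Proof.
split=> [||t]; first exact: can_inj (@bunitK M).
  exact: to_im_surj.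
have cobE v : to_im (bcobound M) v = 0 <->
    bunit (diag_tensor M B) v = diag_map B (bunit M) v.
  split=> [/(congr1 val) d0|vE].
    by apply/eqP; rewrite -subr_eq0; apply/eqP.
  by apply/val_inj/eqP; rewrite subr_eq0; apply/eqP.
split=> [/cobE te|[m <-]]; last exact/cobE/esym/diag_map_pure.
(* Evaluating the last factor of t (x) 1 at the identity gives back t; evaluating that of the other
   side sends m (x) 1 (x) b to b(1) m (x) 1, which is the image of m (x) b under [bunit] after
   [beval]. *)
exists (beval M t).
rewrite -[RHS](@bunitK (diag_tensor M B) t) te.
move: t {te}; apply: diag_morph_ext => [u v|u v|m b].
- by rewrite (linearB (beval M)) linearB.
- by rewrite linearB (linearB (beval _)).
by rewrite diag_map_pure !beval_pure linearZ.
Qed.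

(** The retraction [s] is over RG; it is what makes I (x) i injective for an injective [I]. *)
Definition cofibrant_sequence (K P M : lmodType RG)
    (i : {linear K -> P}) (p : {linear P -> M}) :=
  [/\ projective P, short_exact i p
    & exists s : {linear diag_tensor P B -> diag_tensor K B},
        cancel (diag_map B i) s].

(** * Syzygies and cosyzygies of cofibrant modules *)

Section Steps.
Variable M : lmodType RG.
Hypothesis cofM : cofibrant M.

Let prresMB : projective (resmod (diag_tensor M B)) := projective_res cofM.

Lemma cofibrant_cosyzygy : exists (N Q : lmodType RG)
    (i : {linear M -> Q}) (p : {linear Q -> N}),
  cofibrant N /\ cofibrant_sequence i p.
Proof.
exists (immod (bcobound M)), (diag_tensor M B), (bunit M), (to_im (bcobound M)).
have ex := bcobound_exact M; have exB := diag_map_exact B ex (@bunitK M).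
split; last by split=> //; exists (bmult M); exact: bunit_bmult.
(* The section [u] exhibits N (x) B as a direct summand of M (x) B (x) B. *)
have [u [up _]] := retraction_section exB (@bunit_bmult M).
exact: retract_projective up (projective_diag_tensor2 cofM prresMB).
Qed.

Lemma cofibrant_syzygy : exists (K P : lmodType RG)
    (i : {linear K -> P}) (p : {linear P -> M}),
  cofibrant K /\ cofibrant_sequence i p.
Proof.
(* Over R, [M] is a direct summand of M (x) B. *)
have prM : projective (resmod M).
  exact: (@retract_projective _ _ _ (resmap (bunit M)) _ (@bunitK M) prresMB).
have prP := projective_regular_tensor prM.
(* This sends m (x) g to g g^-1 m = m: it is the augmentation of RG tensored with [M]. It is split
   over R by m |-> m (x) 1. *)
pose p := regular_lift (idfun : {linear resmod M -> resmod M}).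
pose sec := mk_linear (regular_section_linear (M := M)).
have pK : cancel sec p by exact: regular_lift_pure.
pose i : {linear kermod p -> diag_tensor M RG^o} :=
  mk_linear (f := fun x : kermod p => submod_val x) (fun a x y => erefl).
exists (kermod p), (diag_tensor M RG^o), i, p.
have ex : short_exact i p.
  split=> [x y /val_inj//|m|x]; first by exists (sec m); exact: pK.
  split=> [px|[[y yk] <-]]; last exact/eqP.
  by exists (Submod (introT eqP px : x \in ker_pred p)).
have rex : short_exact (resmap i) (resmap p) by [].
have [k [ki _]] := section_retraction rex (u := sec) pK.
have exB := diag_map_exact B ex ki.
have [_ pB_surj _] := exB.
(* Lifting the identity of the projective module M (x) B through p (x) B splits the tensored
   sequence over RG. *)
have [u uE] :=
  cofM (idfun : {linear diag_tensor M B -> diag_tensor M B}) pB_surj.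
have [s [si _]] := section_retraction exB (u := u) uE.
split; last by split=> //; exists s.
exact: retract_projective si (projective_diag_tensor2 prP prresMB).
Qed.
End Steps.
End Cofibrant.

(** * Tensoring with an injective right module *)

Section TensorInjective.
Variables (R : comPzRingType) (G : groupType).
Local Notation RG := (group_ring R G).
Local Notation "''d' r g" := (gr_delta r g : RG)
  (at level 10, r at level 8, g at level 8).
Local Notation B := (BGR R G).

Lemma pointwise_subproof (s : RG) (b : B) :
  @finitely_supported R G (fun x => (s x : R) * bf b x).
Proof.
apply/asboolP; apply: sub_finite_set (gr_supp s) => x /=.
by apply: contra_neq => ->; rewrite mul0r.
Qed.
Definition pointwise (s : RG) (b : B) : RG :=
  GroupRing (pointwise_subproof s b).

Lemma pointwiseE s b x : pointwise s b x = (s x : R) * bf b x.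
Proof. by []. Qed.

Lemma gr_deltaME r g (s : RG) x : ('d r g * s) x = r * (s (g^-1 * x)%g : R).
Proof. exact: gr_sum_delta. Qed.

Lemma pointwise_delta r q g s b :
  pointwise ('d r g * s) ('d q g *: b) = 'd (r * q) g * pointwise s b.
Proof.
apply: gr_ext => x.
by rewrite pointwiseE bf_deltaE !gr_deltaME pointwiseE mulrACA.
Qed.

Lemma pointwise1 s : pointwise s (bone R G) = s.
Proof. by apply: gr_ext => x; rewrite pointwiseE [LHS]mulr1. Qed.

Lemma pointwiseBl s t b : pointwise (s - t) b = pointwise s b - pointwise t b.
Proof. by apply: gr_ext => x; exact: mulrBl. Qed.

Lemma pointwiseDr s b c : pointwise s (b + c) = pointwise s b + pointwise s c.
Proof. by apply: gr_ext => x; exact: mulrDr. Qed.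

Section Pairing.
Variable I : lmodType RG^c.

Lemma copair_subproof (x : I) (b : B) :
  (fun s : RG => (pointwise s b : RG^c) *: x) \in @coind_pred RG I.
Proof. by apply/asboolP => s t; rewrite pointwiseBl; exact: scalerBl. Qed.
(** The product s b is pointwise. For b = 1 this is the embedding x |-> (s |-> x.s) of [I] in
    [coind I]. Working with the pair x, b avoids building I (x)_R B as a right module. *)
Definition copair (x : I) (b : B) : coind I := Coind (copair_subproof x b).

Variable r : {linear coind I -> I}.
Hypothesis rP : forall (f : coind I) x,
  (forall s : RG, f s = (s : RG^c) *: x) -> r f = x.

(* The retraction of I -> I (x) B, x |-> x (x) 1, induced by r. *)
Definition pairing (x : I) (b : B) : I := r (copair x b).

Lemma pairing1 x : pairing x (bone R G) = x.
Proof. by apply: rP => s /=; rewrite pointwise1. Qed.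

Lemma pairingDl x y b : pairing (x + y) b = pairing x b + pairing y b.
Proof.
rewrite -linearD; congr (r _); apply: coind_ext => s.
exact: scalerDr.
Qed.

Lemma pairingDr x b c : pairing x (b + c) = pairing x b + pairing x c.
Proof.
rewrite -linearD; congr (r _); apply: coind_ext => s.
by rewrite /= pointwiseDr; exact: scalerDl.
Qed.

Lemma pairing_delta q g x b :
  pairing (('d q g : RG^c) *: x) b = ('d q g : RG^c) *: pairing x ('d 1 g *: b).
Proof.
rewrite -linearZ; congr (r _); apply: coind_ext => s /=.
rewrite scalerA; congr (_ *: _).
by rewrite pointwise_delta mulr1.
Qed.

Lemma pairingZ q x b :
  pairing x ('d q 1%g *: b) = ('d q 1%g : RG^c) *: pairing x b.
Proof.
rewrite -linearZ; congr (r _); apply: coind_ext => s /=.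
congr (_ *: _).
rewrite -[s in LHS]mul1r pointwise_delta mul1r -[b in RHS]scale1r.
by rewrite pointwise_delta mulr1.
Qed.

Variable K : lmodType RG.

Lemma contract_dbalanced (x : I) :
  dbalanced (fun (k : K) (b : B) => tpure (pairing x b) k).
Proof.
split=> [k k' b|k b b'|q k b]; first exact: tpureDr.
  by rewrite pairingDr tpureDl.
by rewrite pairingZ tpureZ.
Qed.

Definition contract_fun (x : I) : diag_tensor K B -> tensor I K :=
  dlift (fun k b => tpure (pairing x b) k).

Let cB x := dliftB (contract_dbalanced x).

Lemma contract_funDl x x' t :
  contract_fun (x + x') t = contract_fun x t + contract_fun x' t.
Proof.
apply/eqP; rewrite -subr_eq; apply/eqP; move: t.
apply: diag_morph_ext => [u v||k b] /=; last 2 first.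
- exact: cB.
- rewrite /contract_fun !(dlift_pure (contract_dbalanced _)) pairingDl.
  by rewrite tpureDl addrK.
by rewrite /contract_fun !(cB _ u v) opprD addrACA opprD.
Qed.

(** For a group element g, both x.g (x) (k (x) b) and x (x) (g k (x) g b) are sent to
    [pairing x (g b)] tensored with g k. *)
Lemma contract_balanced : balanced contract_fun.
Proof.
split=> [x x' t|x t t'|a x t]; first exact: contract_funDl.
  exact: zmod_morphismD (cB x) t t'.
have f0 u : contract_fun 0 u = 0.
  by apply: (addrI (contract_fun 0 u)); rewrite -contract_funDl !addr0.
elim/gr_ind: a x t => [|a b IHa IHb|q g] x t.
- have -> : (0 : RG^c) *: x = 0 by exact: scale0r.
  by rewrite scale0r f0; exact/esym/(zmod_morphism0 (cB x)).
- have -> : (a + b : RG^c) *: x = (a : RG^c) *: x + (b : RG^c) *: x.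
    exact: scalerDl.
  rewrite contract_funDl IHa IHb scalerDl.
  exact/esym/(zmod_morphismD (cB x)).
move: t; apply: diag_morph_ext => [|u v|k b]; first exact: cB.
  by rewrite scalerBr; exact: cB.
rewrite dpure_delta /contract_fun !(dlift_pure (contract_dbalanced _)).
by rewrite pairing_delta tpureZ.
Qed.

Definition contract : tensor I (diag_tensor K B) -> tensor I K :=
  tensor_lift contract_fun.

Lemma contract_pure x k b :
  contract (tpure x (dpure k b)) = tpure (pairing x b) k.
Proof.
rewrite /contract tensor_lift_pure; last exact: contract_balanced.
exact: dlift_pure (contract_dbalanced x) _ _.
Qed.
End Pairing.

Lemma tmap_injective (I : lmodType RG^c) (K P : lmodType RG)
    (i : {linear K -> P}) (s : {linear diag_tensor P B -> diag_tensor K B}) :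
  injective_module I -> cancel (diag_map B i) s -> injective (tmap I i).
Proof.
move=> /coind_retraction[r rP] si.
(* The left inverse sends x (x) i k to x (x) (i k (x) 1), then by [s] to x (x) (k (x) 1), and
   contracts this to x (x) k. *)
apply: (@can_inj _ _ _
  (fun t => contract r (tmap I s (tmap I (bunit P) t)))).
apply: tensor_morph_ext => [u v|//|x k].
  rewrite !raddfB.
  exact: (tensor_lift_is_zmod_morphism (contract_balanced r K)).
rewrite !tmap_pure -[bunit P _]/(dpure (i k) _) -diag_map_pure si contract_pure.
by rewrite pairing1.
Qed.
End TensorInjective.

(** * Splicing the short exact sequences *)

Lemma splice_acyclic (C M : int -> zmodType) (i : forall n, M (n + 1) -> C n)
    (p : forall n, C n -> M n) :
    (forall n, injective (i n)) -> (forall n, i n 0 = 0) ->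
    (forall n, surjective (p n)) ->
    (forall n x, p n x = 0 <-> exists k, i n k = x) ->
  acyclic (fun n x => i n (p (n + 1) x)).
Proof.
move=> i_inj i0 p_surj ex n x; split=> [|[y <-]].
  rewrite -(i0 n) => /i_inj /ex[k <-]; have [y <-] := p_surj _ k.
  by exists y.
by rewrite (_ : p _ _ = 0) ?i0//; apply/ex; exists (p _ y).
Qed.

Theorem proposition8p2 (R : comPzRingType) (G : groupType)
    (M : lmodType (group_ring R G)) :
  cofibrant M -> PGF M.
Proof.
move=> cofM.
(* Modules are bundled with their cofibrancy so that the chosen syzygy and cosyzygy can be
   iterated. *)
pose T := {N : lmodType (group_ring R G) | cofibrant N}.
pose linked (K N : T) := exists (P : lmodType (group_ring R G))
  (i : {linear sval K -> P}) (p : {linear P -> sval N}), cofibrant_sequence i p.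
have /choice[syz syzP] (N : T) : exists K, linked K N.
  have [K [P [i [p [cK ex]]]]] := cofibrant_syzygy (svalP N).
  by exists (exist _ K cK), P, i, p.
have /choice[cosyz cosyzP] (K : T) : exists N, linked K N.
  have [N [P [i [p [cN ex]]]]] := cofibrant_cosyzygy (svalP K).
  by exists (exist _ N cN), P, i, p.
(* [M] sits in degree 0, with syzygies above and cosyzygies below; [Negz m] stands for -(m+1),
   whence the iteration count [m.+1]. *)
pose M_ (n : int) : T := match n with
  | Posz m => iter m syz (exist _ M cofM)
  | Negz m => iter m.+1 cosyz (exist _ M cofM)
  end.
have link n : linked (M_ (n + 1)) (M_ n).
  (* At n = -1 the index n + 1 computes to 0; the other two cases need n + 1 rewritten. *)
  case: n => [m|[|m]]; [|exact: cosyzP|].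
    by rewrite -PoszD addn1; exact: syzP.
  have -> : Negz m.+1 + 1 = Negz m.
    by rewrite !NegzE -[in LHS]addn1 PoszD opprD subrK.
  exact: cosyzP.
pose P n := sval (cid (link n)).
pose i n := sval (cid (svalP (cid (link n)))).
pose p n := sval (cid (svalP (cid (svalP (cid (link n)))))).
have ip n : @cofibrant_sequence R G _ (P n) _ (i n) (p n).
  exact: (svalP (cid (svalP (cid (svalP (cid (link n))))))).
have ex n : short_exact (i n) (p n) by have [] := ip n.
exists P, (fun n => i n \o p (n + 1) : {linear P (n + 1) -> P n}); split.
- by move=> n; have [] := ip n.
- apply: (@splice_acyclic P (fun n => sval (M_ n))
    (fun n => i n) (fun n => p n)) => n.
  + by have [] := ex n.
  + exact: linear0.
  + by have [] := ex n.
  + by have [] := ex n.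
- move=> I injI.
  have tE : (fun n => tensor_map (idfun : {linear I -> I})
      (i n \o p (n + 1) : {linear P (n + 1) -> P n}) : _ -> _) =
      (fun n x => tmap I (i n) (tmap I (p (n + 1)) x)).
    by apply: functional_extensionality_dep => n; apply/funext => x;
      exact: tmap_comp.
  rewrite [X in acyclic X]tE.
  (* Injectivity on the left comes from the splitting after tensoring with B, the rest from right
     exactness. *)
  apply: (@splice_acyclic (fun n => tensor I (P n))
    (fun n => tensor I (sval (M_ n)))
    (fun n => tmap I (i n)) (fun n => tmap I (p n))) => n.
  + by have [_ _ [s]] := ip n; exact: tmap_injective.
  + exact: raddf0.
  + by apply: tmap_surj; have [] := ex n.
  + move=> x; split; first exact: tmap_right_exact.
    by move=> [k <-]; rewrite -tmap_comp tmap0 // => y; exact: short_exactE.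
(* The differential from degree 0 to degree -1 is [i (-1)] after the surjection onto [M] in degree
   0, so its image is that of [i (-1)]. *)
- exists (-1), (i (-1)); split; first by have [] := ex (-1).
  move=> y; split=> -[x <-]; last by exists (p _ x).
  have [_ ps _] := ex (-1 + 1); have [z <-] := ps x.
  by exists z.
Qed.
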